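(* Let $\mathbb{I}=\mathbb{N}^*$ or $\mathbb{I}=\mathbb{Z}$ and let $z\in\{-1,0,1\}^{\mathbb{I}}$. Then $z$ satisfies condition (S$_0$) if and only if $z$ satisfies condition (S).
   Context: $\mathbb{N}^*=\{1,2,3,\dots\}$; sums $\sum_{n\le N}$ are over $1\le n\le N$. Condition (S$_0$) for $z$: for each homeomorphism $T$ of a compact metric space $X$ with topological entropy $h_{top}(T)=0$, each continuous function $f$ on $X$ and each $x\in X$, $$\frac1N\sum_{n\le N} f(T^nx)z(n)\to 0\quad (N\to\infty).$$ Completely deterministic points: let $T$ be a homeomorphism of a compact metric space $X$ and $x\in X$. The point $x$ is completely deterministic if for every accumulation point $\nu$, in the weak topology on Borel probability measures (convergence of integrals of continuous functions), of the sequence $\left(\frac1N\sum_{n\le N}\delta_{T^nx}\right)_{N\ge1}$, the measure-theoretic (Kolmogorov–Sinai) entropy $h(T,\nu)$ is $0$. Condition (S) for $z$: for each homeomorphism $T$ of a compact metric space $X$, each continuous function $f$ on $X$ and each completely deterministic point $x\in X$, $$\frac1N\sum_{n\le N} f(T^nx)z(n)\to 0\quad (N\to\infty).$$ *)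

(* Defs.v *)
From HB Require Import structures.
From mathcomp Require Import all_boot all_order all_algebra.
From mathcomp Require Import all_classical all_reals all_analysis.

Set Implicit Arguments.
Unset Strict Implicit.
Unset Printing Implicit Defensive.

Import Order.TTheory GRing.Theory Num.Theory.
Import numFieldNormedType.Exports.

Local Open Scope classical_set_scope.
Local Open Scope ring_scope.

(* The library's measurable types are pointed, so the metric spaces below carry
   a base point. It is used nowhere else; only nonemptiness is assumed, and
   both (S_0) and (S) quantify over a point of the space anyway. *)
#[short(type="pointedMetricType")]
HB.structure Definition PointedMetric (R : numDomainType) :=
  {T of Pointed T & Metric R T}.

Definition homeomorphism (X : topologicalType) (T : X -> X) : Prop :=
  continuous T /\
  exists S : X -> X, [/\ cancel T S, cancel S T & continuous S].

Section topological_entropy.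
Context {R : realType} {X : topologicalType}.
Implicit Types (T : X -> X) (U : set (set X)).

Definition open_cover U : Prop :=
  U `<=` open /\ \bigcup_(A in U) A = setT.

(* The join of the covers T^{-i} U for 0 <= i < n. *)
Definition cover_join T U (n : nat) : set (set X) :=
  [set \bigcap_(i < n) (iter i T @^-1` a i)
    | a in [set a : nat -> set X | forall i, U (a i)]].

(* Minimal cardinality of a subcover (the infimum is over natural numbers, and
   over a nonempty set when X is compact and U is an open cover). *)
Definition cover_number U : R :=
  inf [set k%:R | k in [set k : nat | exists V : set (set X),
    [/\ V `<=` U, (V #= `I_k)%card & \bigcup_(A in V) A = setT]]].

(* Adler-Konheim-McAndrew. The sequence converges by subadditivity, so that its
   upper limit is its limit. *)
Definition cover_entropy T U : \bar R :=
  limn_esup (fun n => (ln (cover_number (cover_join T U n)) / n%:R)%:E).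

Definition top_entropy T : \bar R :=
  ereal_sup [set cover_entropy T U | U in open_cover].

End topological_entropy.

Section measure_entropy.
Context d {X : measurableType d} {R : realType}.
Implicit Types (T : X -> X) (mu : probability X R).

(* A finite partition is encoded by the map sending a point to the label of its
   cell; unused labels (empty cells) contribute 0 to the entropy. *)
Definition partition_entropy (I : finType) mu (xi : X -> I) : R :=
  - \sum_(i : I) fine (mu (xi @^-1` [set i])) * ln (fine (mu (xi @^-1` [set i]))).

Definition measurable_partition (I : finType) (xi : X -> I) : Prop :=
  forall i, measurable (xi @^-1` [set i]).

(* The join of the partitions T^{-i} xi for 0 <= i < n. *)
Definition partition_join (I : finType) T (xi : X -> I) (n : nat) :
  X -> {ffun 'I_n -> I} := fun x => [ffun i : 'I_n => xi (iter i T x)].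

(* For a T-invariant mu the sequence converges by subadditivity, so that its
   upper limit is its limit. *)
Definition ks_entropy_partition (I : finType) T mu (xi : X -> I) : \bar R :=
  limn_esup (fun n => (partition_entropy mu (partition_join T xi n) / n%:R)%:E).

Definition ks_entropy T mu : \bar R :=
  ereal_sup [set h | exists k : nat, exists xi : X -> 'I_k,
    measurable_partition xi /\ h = ks_entropy_partition T mu xi].

End measure_entropy.

Definition borel {R : realType} (X : pointedMetricType R) :=
  g_sigma_algebraType (@open X).

Section weak_topology.
Context {R : realType} {X : pointedMetricType R}.

Definition integrals (mu : probability (borel X) R) :
    {ptws continuousType X R -> R} :=
  fun f => \int[mu]_x f x.

(* Borel probability measures with the coarsest topology making all the maps
   mu |-> \int f dmu, f continuous, continuous. *)
Definition weak_probability : topologicalType := initial_topology integrals.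

End weak_topology.
Arguments weak_probability {R} X.

Section empirical_measure.
Context {R : realType} {X : pointedMetricType R}.
Variables (T : X -> X) (x : X) (N : nat).

(* The average of the Dirac masses at T^1 x, ..., T^(N+1) x. *)
Definition empirical : set (borel X) -> \bar R :=
  mscale (N.+1%:R^-1)%:nng
    (msum (fun n => @dirac _ (borel X) (iter n.+1 T x) R) N.+1).

HB.instance Definition _ := Measure.on empirical.

Let empirical_setT : empirical setT = 1%E.
Proof.
rewrite /empirical /mscale /= /msum /=.
rewrite (eq_bigr (fun=> 1%E)); last by move=> n _; rewrite diracT.
by rewrite sumEFin sumr_const card_ord -EFinM mulVf.
Qed.

HB.instance Definition _ :=
  Measure_isProbability.Build _ _ _ empirical empirical_setT.

Definition empirical_probability : weak_probability X :=
  (empirical : probability (borel X) R).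

End empirical_measure.

Definition completely_deterministic (R : realType) (X : pointedMetricType R)
    (T : X -> X) (x : X) : Prop :=
  forall nu : weak_probability X,
    cluster (empirical_probability T x @ \oo) nu ->
    ks_entropy (T : borel X -> borel X) (nu : probability (borel X) R) = 0%E.

Variant index_set := PosNat | AllInt.

Definition index_sort (I : index_set) : Type :=
  match I with PosNat => {n : nat | (0 < n)%N} | AllInt => int end.
Coercion index_sort : index_set >-> Sortclass.

(* The positive integer n + 1 as an index. *)
Definition index_succ (I : index_set) (n : nat) : I :=
  match I with
  | PosNat => exist (fun m : nat => (0 < m)%N) n.+1 (ltn0Sn n)
  | AllInt => n.+1%:Z
  end.

Section sarnak_conditions.
Context {R : realType} {I : index_set}.

(* N^{-1} \sum_{1 <= m <= N} f(T^m x) z(m), with m = n + 1. *)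
Definition weighted_average (X : Type) (T : X -> X) (f : X -> R) (x : X)
    (z : I -> R) (N : nat) : R :=
  N%:R^-1 * \sum_(n < N) f (iter n.+1 T x) * z (index_succ I n).

Definition condition_S0 (z : I -> R) : Prop :=
  forall (X : pointedMetricType R) (T : X -> X),
    compact [set: X] -> homeomorphism T -> top_entropy T = 0%E :> \bar R ->
  forall (f : X -> R) (x : X), continuous f ->
    weighted_average T f x z @ \oo --> (0 : R).

Definition condition_S (z : I -> R) : Prop :=
  forall (X : pointedMetricType R) (T : X -> X),
    compact [set: X] -> homeomorphism T ->
  forall (f : X -> R) (x : X), continuous f -> completely_deterministic T x ->
    weighted_average T f x z @ \oo --> (0 : R).

End sarnak_conditions.

(* Main.v *)
Require Import Defs.
From HB Require Import structures.
From mathcomp Require Import all_boot all_order all_algebra.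
From mathcomp Require Import all_classical all_reals all_analysis.
From mathcomp Require Import measurable_realfun.
From mathcomp Require Import ring lra zify.

(* (S) implies (S_0) because accumulation points of empirical measures are
   invariant, and an invariant measure of a zero entropy system has zero entropy.

   For the converse, suppose that the averages of f(T^n x) z(n) stay away from 0
   along a set of times, and let U be an ultrafilter containing it. The limit
   along U of the empirical measures is an invariant measure nu of zero entropy.
   Quantize f by thresholds that are nu-null: along U, the symbolic orbit q is
   then covered, up to small density and at every large scale K, by exp(o(K))
   words of length K. Choose nested scales K_0 | K_1 | ... with nested phases,
   and blank out every aligned block of q that is bad at some scale K_j, the
   scale K_j being used only beyond a threshold W_j that grows fast enough. The
   resulting sequence y differs from q with small density at infinitely many of
   the given times, and its words have zero exponential growth rate, so that its
   two-sided orbit closure has zero topological entropy. Hence z correlates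
   with y, which contradicts (S_0). *)

Set Implicit Arguments.
Unset Strict Implicit.
Unset Printing Implicit Defensive.

Import Order.TTheory GRing.Theory Num.Theory.
Import numFieldNormedType.Exports.

Local Open Scope classical_set_scope.
Local Open Scope ring_scope.

(** * Borel measures from finitely additive ones *)

(** Complete determinism concerns the orbit of [x] alone: the ambient system may have positive
    entropy, so the orbit has to be transplanted into another system, which is done through symbols.
    Along an ultrafilter the frequencies of all sets converge at once, but their limit is only
    finitely additive. It is turned into a Borel measure by an outer measure built from open sets,
    and only upper bounds on closed sets survive. This is why the thresholds must be null: off a
    null set, the points with a good word then form an open set, whose complement obeys such a
    bound. Each scale controls its bad blocks on a set of the ultrafilter, and only finitely many
    such sets share a given time; hence the delays [W]. Nesting keeps the word count low: seen from
    one aligned block, larger scales blank all of it or nothing, and smaller scales decide from the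
    word of [q] inside it. Blanking thus adds a single word to those allowed at that scale. *)

Section distance_to_set.
Context {R : realType} {X : metricType R}.
Implicit Types (F : set X) (x y : X).

(** For empty [F] the infimum takes its default value 0, so the lemmas that separate a point from
    [F] ask for [F !=set0]. *)
Definition setdist F x : R := inf [set mdist x y | y in F].

Lemma setdist_has_inf F x : F !=set0 -> has_inf [set mdist x y | y in F].
Proof.
move=> [y Fy]; split; first by exists (mdist x y), y.
by exists 0 => _ [z _ <-]; exact: mdist_ge0.
Qed.

Lemma setdist_ge0 F x : 0 <= setdist F x.
Proof.
have [->|/set0P F0] := eqVneq F set0; first by rewrite /setdist image_set0 inf0.
apply: lb_le_inf; first by case: (setdist_has_inf x F0).
by move=> _ [z _ <-]; exact: mdist_ge0.
Qed.

Lemma setdist_le F x y : F y -> setdist F x <= mdist x y.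
Proof.
move=> Fy; apply: ge_inf; last by exists y.
by exists 0 => _ [z _ <-]; exact: mdist_ge0.
Qed.

Lemma setdist_lipschitz F x y : setdist F x <= mdist x y + setdist F y.
Proof.
have [->|/set0P F0] := eqVneq F set0.
  by rewrite /setdist !image_set0 inf0 addr0 mdist_ge0.
rewrite -lerBlDl; apply: lb_le_inf; first by case: (setdist_has_inf y F0).
move=> _ [z Fz <-]; rewrite lerBlDl.
exact: le_trans (setdist_le x Fz) (metric_triangle _ _ _).
Qed.

Lemma setdist_continuous F : continuous (setdist F).
Proof.
move=> x; apply/cvgrPdist_le => e e0; near=> y.
have xy : mdist x y <= e.
  apply: ltW; near: y; have := nbhsx_ballx x e e0.
  by rewrite ballEmdist.
rewrite ler_norml; have := setdist_lipschitz F x y.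
have := setdist_lipschitz F y x; rewrite (metric_sym y x); lra.
Unshelve. all: by end_near. Qed.

Lemma setdist_in F x : F x -> setdist F x = 0.
Proof.
move=> Fx; apply/eqP; rewrite eq_le setdist_ge0 andbT.
by rewrite -(mdistxx x); exact: setdist_le.
Qed.

Lemma setdist_gt0 F x : F !=set0 -> closed F -> ~ F x -> 0 < setdist F x.
Proof.
move=> F0 cF Fx; have /nbhs_ballP[e e0 be] : nbhs x (~` F).
  by apply: open_nbhs_nbhs; split => //; exact: closed_openC.
apply: (lt_le_trans e0); apply: lb_le_inf.
  by case: (setdist_has_inf x F0).
move=> _ [y Fy <-]; rewrite leNgt; apply/negP => xy.
by apply: (be y) Fy; rewrite ballEmdist.
Qed.

End distance_to_set.

Section content_extension.
Context {R : realType} {X : pointedMetricType R}.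
Variable m : set X -> R.
Hypothesis m_ge0 : forall A, 0 <= m A.
Hypothesis mU : forall A B, A `&` B = set0 -> m (A `|` B) = m A + m B.

Lemma content0 : m set0 = 0.
Proof. by have := @mU set0 set0 (set0I _); rewrite setU0; lra. Qed.

Lemma le_content A B : A `<=` B -> m A <= m B.
Proof.
move=> AB; rewrite -(setDUK AB) mU ?setDIK//.
by rewrite lerDl.
Qed.

Lemma content_subadditive A B : m (A `|` B) <= m A + m B.
Proof.
have -> : A `|` B = A `|` (B `\` A) by rewrite setUDr setDv setD0.
rewrite mU ?setDIK// lerD2l; apply: le_content; exact: subDsetl.
Qed.

(* The value +oo off the open sets turns the library's mu_ext, which uses covers
   by measurable sets, into an infimum over open covers. *)
Definition open_content (A : set X) : \bar R :=
  if `[< open A >] then (m A)%:E else +oo%E.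

Lemma open_content0 : open_content set0 = 0%E.
Proof. by rewrite /open_content asboolT ?content0//; exact: open0. Qed.

Lemma open_content_ge0 A : (0 <= open_content A)%E.
Proof. by rewrite /open_content; case: asboolP => // _; rewrite lee_fin. Qed.

Definition content_ext (A : set X) : \bar R := @mu_ext _ (borel X) R open_content A.

HB.instance Definition _ := isOuterMeasure.Build R X content_ext
  (@mu_ext0 _ (borel X) _ _ open_content0 open_content_ge0)
  (@mu_ext_ge0 _ (borel X) _ _ open_content_ge0)
  (@le_mu_ext _ (borel X) _ _)
  (@mu_ext_sigma_subadditive _ (borel X) _ _ open_content_ge0).

Lemma content_ext_le A (G : (set X)^nat) : (forall i, open (G i)) ->
  A `<=` \bigcup_i G i -> (content_ext A <= \sum_(i <oo) (m (G i))%:E)%E.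
Proof.
move=> oG AG; apply: ereal_inf_lbound; exists G.
  by split => // i; apply: sub_sigma_algebra; exact: oG.
by apply: eq_eseriesr => i _; rewrite /open_content asboolT.
Qed.

Lemma content_ext_ge A (r : \bar R) :
  (forall G : (set X)^nat, (forall i, open (G i)) -> A `<=` \bigcup_i G i ->
    (r <= \sum_(i <oo) (m (G i))%:E)%E) -> (r <= content_ext A)%E.
Proof.
move=> H; apply: le_ereal_inf_tmp => _ [G [_ AG] <-].
have [oG|] := pselect (forall i, open (G i)).
  rewrite (@eq_eseriesr _ _ (fun i => (m (G i))%:E)) ?H// => i _.
  by rewrite /open_content asboolT.
move=> /existsNP[i oGi]; rewrite (@eseries_pinfty _ _ xpredT i) ?leey//.
  by move=> n _; rewrite -ltNye (lt_le_trans _ (open_content_ge0 _)).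
by rewrite /open_content asboolF.
Qed.

Lemma content_ext_open A : open A -> (content_ext A <= (m A)%:E)%E.
Proof.
move=> oA; pose G := bigcup2 A (set0 : set X).
apply: (le_trans (@content_ext_le _ G _ _)).
- by case => [|[|n]]//=; exact: open0.
- by move=> x Ax; exists 0%N.
rewrite nneseries_recl//; last by move=> *; rewrite lee_fin.
rewrite eseries_cond/= eseries0 ?adde0// => -[|[|k]]//= _ _.
all: by rewrite ?content0.
Qed.

(** Compactness reduces an open cover to a finite one, where finite subadditivity of [m] is enough.
    The converse inequality can fail: [m] may vanish on a point that its mass only approaches. *)
Lemma content_ext_closed F : compact [set: X] -> closed F ->
  ((m F)%:E <= content_ext F)%E.
Proof.
move=> cptX cF; apply: content_ext_ge => G oG FG.
have : compact F by apply: (subclosed_compact cF cptX).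
rewrite compact_cover => /(_ _ setT G (fun i _ => oG i) FG)[D _ FD].
pose n := (\max_(i <- finmap.enum_fset D) i).+1.
apply: (@le_trans _ _ (\sum_(0 <= i < n) (m (G i))%:E)%E); last first.
  apply: nneseries_lim_ge => i _; by rewrite lee_fin.
have -> : (\sum_(0 <= i < n) (m (G i))%:E)%E = (\sum_(0 <= i < n) m (G i))%:E.
  by rewrite sumEFin.
rewrite lee_fin; apply: (@le_trans _ _ (m (\big[setU/set0]_(0 <= i < n) G i))).
  apply: le_content; apply: (subset_trans FD) => x [i iD Gix].
  rewrite big_mkord -bigcup_mkord; exists i => //=.
  rewrite /n ltnS.
  exact: (@leq_bigmax_seq _ _ xpredT id).
elim: n => [|n IH]; first by rewrite !big_nil content0.
rewrite !big_nat_recr//=; apply: le_trans (content_subadditive _ _) _.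
by rewrite lerD2r.
Qed.

Section shells.
Variables U G : set X.
Hypotheses (oU : open U) (oG : open G) (G'0 : ~` G !=set0).

Let rho := setdist (~` G).
Let V n : set X := rho @^-1` [set t | n.+1%:R^-1 < t].
(** Open shells around the complement of [G]. [S n] and [S n.+1] overlap, so that open sets can
    cover every level of [rho]; [S n] and [S n.+2] are disjoint. *)
Let S n : set X := rho @^-1` [set t | n.+3%:R^-1 < t < n.+1%:R^-1].
Let a n := m (U `&` V n).

Let oV n : open (V n).
Proof.
apply: open_comp; last exact: open_gt.
by move=> x _; exact: setdist_continuous.
Qed.

Let oS n : open (S n).
Proof.
apply: open_comp; first by move=> x _; exact: setdist_continuous.
rewrite (_ : [set t | _] = [set t | n.+3%:R^-1 < t] `&` [set t | t < n.+1%:R^-1]).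
  by apply: openI; [exact: open_gt|exact: open_lt].
by apply/seteqP; split => x /=; [move/andP|move=> ?; apply/andP].
Qed.

Let oW n : open (rho @^-1` [set t | t < n.+1%:R^-1]).
Proof.
apply: open_comp; last exact: open_lt.
by move=> x _; exact: setdist_continuous.
Qed.

Let a_le n : a n <= m U. Proof. by apply: le_content; exact: subIsetl. Qed.

Let a_nd n : a n <= a n.+1.
Proof.
apply: le_content => x [Ux]; rewrite /V/= => Vx; split => //.
by apply: le_lt_trans Vx; rewrite lef_pV2 ?posrE// ler_nat.
Qed.

Let S_le n : m (U `&` S n) <= a n.+2 - a n.
Proof.
rewrite lerBrDr -mU; last first.
  rewrite -subset0 => x [[_ /andP[_ +]] [_]] /=; rewrite /V/= => h1 h2.
  by have := lt_trans h1 h2; rewrite ltxx.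
apply: le_content => x [] [Ux].
  by move=> /andP[? _].
rewrite /V/= => Vx; split => //.
by apply: le_lt_trans Vx; rewrite lef_pV2 ?posrE// ler_nat -addn2 leq_addr.
Qed.

Let coverG n : U `&` G `<=` U `&` V n.+1 `|` \bigcup_i (U `&` S (n + i)%N).
Proof.
move=> x [Ux Gx]; have r0 : 0 < rho x.
  by apply: setdist_gt0 => //; exact: open_closedC.
have [Vx|nVx] := pselect (V n.+1 x); [by left|right].
have /negP := nVx; rewrite -leNgt => rn.
have ex : exists k, k.+1%:R^-1 < rho x.
  exists (Num.truncn (rho x)^-1); rewrite -[ltRHS]invrK ltf_pV2 ?posrE ?invr_gt0//.
  exact: truncnS_gt.
have kP := ex_minnP ex; case: kP => k kr kmin.
have nk : (n.+2 < k.+1)%N.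
  rewrite -(ltr_nat R) -ltf_pV2 ?posrE//.
  exact: (lt_le_trans kr rn).
(* By minimality of [k], [rho x] is above 1/(k+1) and at most 1/k, hence inside the shell of index
   [k - 2]; [nk] makes the truncated subtractions exact. *)
exists (k - 2 - n)%N => //; split => //; rewrite /S/=.
have -> : (n + (k - 2 - n) = k - 2)%N by lia.
apply/andP; split; first by have -> : ((k - 2).+3 = k.+1)%N by lia.
rewrite ltNge; apply/negP => h.
suff : (k <= k.-1)%N by lia.
apply: kmin; apply: lt_le_trans h.
rewrite ltf_pV2 ?posrE// ltr_nat; lia.
Qed.

(** The bounds of [S_le] telescope in steps of two, which leaves two terms at each end. *)
Let sum_S n N : \sum_(0 <= i < N) m (U `&` S (n + i)%N) <=
  a (n + N)%N + a (n + N).+1 - a n - a n.+1.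
Proof.
elim: N => [|N IH]; first by rewrite big_nil addn0; lra.
by rewrite big_nat_recr//= addnS; have := S_le (n + N)%N; lra.
Qed.

Let ext_UG n : (content_ext (U `&` G) <= (3 * sup (range a) - 2 * a n)%:E)%E.
Proof.
have supa k : a k <= sup (range a).
  by apply: ub_le_sup; [exists (m U) => _ [i _ <-]|exists k].
pose F i := if i is i'.+1 then U `&` S (n + i')%N else U `&` V n.+1.
apply: (le_trans (@content_ext_le _ F _ _)).
- by case=> [|i]; apply: openI.
- move=> x /(coverG n)[h|[i _ h]]; first by exists 0%N.
  by exists i.+1.
apply: lime_le; first by apply: is_cvg_nneseries => *; rewrite lee_fin.
near=> N; have : (0 < N)%N by near: N; exact: nbhs_infty_gt.
move=> /prednK <-; move: N.-1 => k; rewrite sumEFin lee_fin big_nat_recl//=.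
have := sum_S n k; have := supa (n + k)%N; have := supa (n + k).+1.
have := supa n.+1; rewrite -/(a n.+1); have := a_nd n; lra.
Unshelve. all: by end_near. Qed.

Let ext_UGC n : (content_ext (U `&` ~` G) <= (m U - a n)%:E)%E.
Proof.
apply: (@le_trans _ _ (content_ext (U `&` rho @^-1` [set t | t < n.+1%:R^-1]))).
  apply: le_outer_measure => x [Ux Gx]; split => //=.
  by rewrite /rho setdist_in.
apply: le_trans (content_ext_open _) _; first exact: openI.
rewrite lee_fin lerBrDr -mU; last first.
  rewrite -subset0 => x [[_ +] [_]] /=; rewrite /V/= => h1 h2.
  by have := lt_trans h1 h2; rewrite ltxx.
by apply: le_content => x [] [].
Qed.

(* m is only finitely additive, so U `&` G is exhausted from inside by the V n,
   and the rest is covered by the overlapping shells S, whose total content is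
   at most 2 (sup a - a n). *)
Lemma content_ext_split :
  (content_ext (U `&` G) + content_ext (U `&` ~` G) <= (m U)%:E)%E.
Proof.
apply/lee_addgt0Pr => e e0.
have ha : has_sup (range a).
  by split; [exists (a 0%N), 0%N|exists (m U) => _ [i _ <-]].
have e3 : 0 < e / 3 by rewrite divr_gt0.
have [_ [n _ <-] an] := sup_adherent e3 ha.
apply: le_trans (leeD (ext_UG n) (ext_UGC n)) _.
rewrite -!EFinD lee_fin; lra.
Qed.

End shells.

(** Splitting an open set is enough: for an arbitrary [A], the inequality is summed over the members
    of an open cover of [A]. *)
Lemma content_ext_caratheodory G : open G -> caratheodory_measurable content_ext G.
Proof.
move=> oG; apply: le_caratheodory_measurable => A.
have [G'0|/set0P G'0] := eqVneq (~` G) set0.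
  have -> : G = setT by rewrite -(setCK G) G'0 setC0.
  by rewrite setCT setI0 outer_measure0 adde0 setIT.
apply: content_ext_ge => F oF AF.
apply: (@le_trans _ _ (\sum_(i <oo) content_ext (F i `&` G) +
    \sum_(i <oo) content_ext (F i `&` ~` G))%E).
  apply: leeD.
    apply: le_trans (outer_measure_sigma_subadditive content_ext _).
    by apply: le_outer_measure; rewrite -setI_bigcupl; exact: setSI.
  apply: le_trans (outer_measure_sigma_subadditive content_ext _).
  by apply: le_outer_measure; rewrite -setI_bigcupl; exact: setSI.
rewrite -nneseriesD; [|by move=> *; exact: outer_measure_ge0..].
apply: lee_nneseries => [i _ _|i _].
  by apply: adde_ge0; exact: outer_measure_ge0.
exact: content_ext_split.
Qed.

Lemma borel_caratheodory (A : set (borel X)) : measurable A ->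
  caratheodory_measurable content_ext A.
Proof.
apply: smallest_sub; last exact: content_ext_caratheodory.
split.
- exact: caratheodory_measurable_set0.
- by move=> B mB; rewrite setTD; exact: caratheodory_measurable_setC.
- by move=> F mF; exact: caratheodory_measurable_bigcup.
Qed.

Hypothesis cptX : compact [set: X].
Hypothesis mT : m setT = 1.

Definition content_measure : set (borel X) -> \bar R := content_ext.

Let content_measure_sigma_additive : semi_sigma_additive content_measure.
Proof.
move=> F mF tF mUF; apply: caratheodory_measure_sigma_additive => //.
- by move=> i; exact: borel_caratheodory.
- exact: borel_caratheodory.
Qed.

HB.instance Definition _ := isMeasure.Build _ (borel X) R content_measure
  (outer_measure0 content_ext) (outer_measure_ge0 content_ext)
  content_measure_sigma_additive.

Let content_measure_setT : content_measure setT = 1%E.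
Proof.
apply/eqP; rewrite eq_le -mT; apply/andP; split.
  by apply: content_ext_open; exact: openT.
by apply: content_ext_closed => //; exact: closedT.
Qed.

HB.instance Definition _ :=
  Measure_isProbability.Build _ _ _ content_measure content_measure_setT.

(** The measure and [m] may differ. The bound on closed sets is the half of the comparison from
    which weak convergence follows. *)
Lemma content_probability : exists nu : probability (borel X) R,
  forall F : set X, closed F -> ((m F)%:E <= nu F)%E.
Proof.
exists (content_measure : probability (borel X) R) => F cF.
exact: content_ext_closed.
Qed.

End content_extension.

(** * Weak convergence *)

Section borel_integrals.
Context {R : realType} {X : pointedMetricType R}.
Implicit Types (mu : probability (borel X) R) (f g : X -> R) (A : set X).

Lemma open_borel A : open A -> measurable (A : set (borel X)).
Proof. exact: sub_sigma_algebra. Qed.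

Lemma closed_borel A : closed A -> measurable (A : set (borel X)).
Proof.
move=> cA; rewrite -(setCK A); apply: measurableC.
by apply: open_borel; exact: closed_openC.
Qed.

Lemma continuous_borel f : continuous f -> measurable_fun [set: borel X] f.
Proof.
move=> /continuousP cf; apply: (measurability _ (RGenOInfty.measurableE R)).
move=> _ [_ [a ->] <-]; rewrite setTI; apply: open_borel; apply: cf.
exact: itv_open_ends_open.
Qed.

Lemma continuous_bounded f : compact [set: X] -> continuous f ->
  exists M : R, 0 < M /\ forall x, `|f x| <= M.
Proof.
move=> cptX cf.
have cptf : compact (f @` setT).
  by apply: continuous_compact => //; exact: continuous_subspaceT.
have [M [_ HM]] := compact_bounded cptf.
exists (`|M| + 1); split; first by rewrite ltr_wpDl.
move=> x; apply: (HM (`|M| + 1)); last by exists x.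
by rewrite (le_lt_trans (ler_norm _))// ltrDl.
Qed.

Lemma bounded_integrable mu g (M : R) : measurable_fun [set: borel X] g ->
  (forall x, `|g x| <= M) -> mu.-integrable setT (EFin \o g).
Proof.
move=> mg gM; apply: measurable_bounded_integrable => //.
  by rewrite [ltLHS]probability_setT ltry.
exists M; split; first exact: num_real.
by move=> t Mt x _; exact: le_trans (gM x) (ltW Mt).
Qed.

Lemma continuous_integrable mu f : compact [set: X] -> continuous f ->
  mu.-integrable [set: borel X] (EFin \o f).
Proof.
move=> cptX cf; have [M [_ fM]] := continuous_bounded cptX cf.
exact: bounded_integrable (continuous_borel cf) fM.
Qed.

Definition prob mu A : R := fine (mu A).

Lemma probE mu A : measurable (A : set (borel X)) -> mu A = (prob mu A)%:E.
Proof. by move=> mA; rewrite /prob fineK//; exact: fin_num_measure. Qed.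

Lemma prob_ge0 mu A : 0 <= prob mu A.
Proof. by rewrite /prob fine_ge0. Qed.

Lemma le_prob mu A B : measurable (A : set (borel X)) ->
  measurable (B : set (borel X)) -> A `<=` B -> prob mu A <= prob mu B.
Proof.
by move=> mA mB AB; rewrite -lee_fin -!probE// le_measure ?inE.
Qed.

Lemma probT mu : prob mu setT = 1.
Proof. by rewrite /prob probability_setT. Qed.

Lemma probC mu A : measurable (A : set (borel X)) -> prob mu (~` A) = 1 - prob mu A.
Proof. by move=> mA; rewrite /prob probability_setC// probE. Qed.

Lemma Rintegral_indic mu A : measurable (A : set (borel X)) ->
  \int[mu]_x (\1_A x) = prob mu A.
Proof. by move=> mA; rewrite /Rintegral integral_indic// setIT. Qed.

Section layer_cake.
Variables (mu : probability (borel X) R) (g : X -> R) (K : nat).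
Hypotheses (mg : measurable_fun [set: borel X] g) (K0 : (0 < K)%N).
Hypothesis g01 : forall x, 0 <= g x <= 1.

Let A (j : nat) : set X := [set x | j.+1%:R / K%:R <= g x].
(** [g] rounded down to a multiple of 1/K, written with indicators of superlevel sets. For
    continuous [g] these are closed, so integrals can be bounded through probabilities of closed
    sets. *)
Let h x := K%:R^-1 * \sum_(j < K) (\1_(A j) x) : R.

Let mA j : measurable (A j : set (borel X)).
Proof.
have -> : A j = setT `&` g @^-1` `[j.+1%:R / K%:R, +oo[.
  by rewrite setTI; apply/seteqP; split => x /=; rewrite in_itv/= andbT.
exact: mg.
Qed.

Let hE x : h x = K%:R^-1 * (Num.truncn (K%:R * g x))%:R.
Proof.
have /andP[g0 g1] := g01 x.
congr (_ * _); set n := Num.truncn _.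
have nK : (n <= K)%N.
  by rewrite -(ler_nat R) (@le_trans _ _ (K%:R * g x)) ?truncn_le ?mulr_ge0// ler_piMr.
transitivity (\sum_(j < K) (if (j < n)%N then 1 else 0) : R).
  apply: eq_bigr => j _; rewrite indicE.
  rewrite (_ : (x \in A j) = (j < n)%N); first by case: ifP.
  rewrite truncn_gt_nat; apply/idP/idP; rewrite inE /A/= ler_pdivrMr ?ltr0n//;
    by rewrite mulrC.
by rewrite -big_mkcond/= -(big_ord_widen K (fun=> 1) nK) sumr_const card_ord.
Qed.

Let mh : measurable_fun [set: borel X] h.
Proof.
apply: measurable_funM => //; apply: measurable_sum => j.
exact: measurable_indic.
Qed.

Let h_bounded x : `|h x| <= 1.
Proof.
have /andP[g0 g1] := g01 x; rewrite hE ger0_norm ?mulr_ge0//.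
rewrite mulrC ler_pdivrMr ?ltr0n// mul1r (@le_trans _ _ (K%:R * g x)) ?truncn_le ?mulr_ge0//.
by rewrite ler_piMr.
Qed.

Let int_h : \int[mu]_x h x = K%:R^-1 * \sum_(j < K) prob mu (A j).
Proof.
rewrite RintegralZl//; last first.
  apply: (@bounded_integrable mu _ K%:R).
    by apply: measurable_sum => j; exact: measurable_indic.
  move=> x; rewrite ger0_norm ?sumr_ge0//.
  apply: (@le_trans _ _ (\sum_(j < K) 1)); last by rewrite sumr_const card_ord.
  by apply: ler_sum => j _; rewrite indicE; case: (_ \in _).
congr (_ * _); rewrite /Rintegral.
under eq_integral do rewrite -sumEFin.
rewrite ge0_integral_sum//; last first.
  by move=> j; apply/measurable_EFinP; exact: measurable_indic.
rewrite (eq_bigr (fun j : 'I_K => (prob mu (A j))%:E)) ?sumEFin// => j _.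
by rewrite integral_indic// setIT; exact: probE.
Qed.

Let ig : mu.-integrable [set: borel X] (EFin \o g).
Proof.
apply: (@bounded_integrable mu g 1 mg) => x; have /andP[g0 g1] := g01 x.
by rewrite ger0_norm.
Qed.

Let ih : mu.-integrable [set: borel X] (EFin \o h).
Proof. exact: bounded_integrable mh h_bounded. Qed.

Lemma layer_cake_le :
  K%:R^-1 * \sum_(j < K) prob mu [set x | j.+1%:R / K%:R <= g x] <=
  \int[mu]_x g x.
Proof.
rewrite -int_h; apply: le_Rintegral => // x _; rewrite hE.
have /andP[g0 g1] := g01 x.
by rewrite mulrC ler_pdivrMr ?ltr0n// mulrC truncn_le mulr_ge0.
Qed.

Lemma layer_cake_ge : \int[mu]_x g x <=
  K%:R^-1 + K%:R^-1 * \sum_(j < K) prob mu [set x | j.+1%:R / K%:R <= g x].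
Proof.
rewrite -int_h; apply: (@le_trans _ _ (\int[mu]_x (K%:R^-1 + h x))).
  apply: le_Rintegral => //.
    apply: (@bounded_integrable mu _ (K%:R^-1 + 1)).
      exact: measurable_funD.
    move=> x; rewrite (le_trans (ler_normD _ _))// lerD// ger0_norm//.
  move=> x _; rewrite hE; have /andP[g0 g1] := g01 x.
  rewrite -{1}[K%:R^-1]mulr1 -mulrDr mulrC ler_pdivlMr ?ltr0n//.
  by rewrite mulrC addrC natr1 ltW// truncnS_gt.
rewrite RintegralD//; last exact: finite_measure_integrable_cst.
by rewrite Rintegral_cst// -/(prob mu setT) probT mulr1.
Qed.

End layer_cake.

Section portmanteau.
Variables (U : set_system nat) (P : nat -> probability (borel X) R)
  (nu : probability (borel X) R).
Hypotheses (FU : ProperFilter U) (cptX : compact [set: X]).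
Hypothesis P_closed : forall F, closed F -> forall e : R, 0 < e ->
  \forall N \near U, prob (P N) F <= prob nu F + e.

Let upper g : continuous g -> (forall x, 0 <= g x <= 1) -> forall e : R, 0 < e ->
  \forall N \near U, \int[P N]_x g x <= \int[nu]_x g x + e.
Proof.
move=> cg g01 e e0; have mg := continuous_borel cg.
(* Half of [e] pays for the rounding error 1/K, the other half for the [K] closed level sets. *)
pose K := (Num.truncn (2 / e)).+1.
have Ke : K%:R^-1 <= e / 2.
  rewrite -[leRHS]invrK lef_pV2 ?posrE ?invr_gt0 ?divr_gt0//.
  by rewrite invf_div ltW// truncnS_gt.
have e2 : 0 < e / 2 by rewrite divr_gt0.
pose A (j : nat) : set X := [set x | j.+1%:R / K%:R <= g x].
have : \forall N \near U, forall j : 'I_K, prob (P N) (A j) <= prob nu (A j) + e / 2.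
  apply: filter_forall => j; apply: P_closed => //.
  apply: (closed_comp (f := g) (D := [set t | j.+1%:R / K%:R <= t])).
    by move=> x _; exact: cg.
  exact: closed_ge.
apply: filterS => N HN.
apply: le_trans (layer_cake_ge (P N) mg (ltn0Sn _ : (0 < K)%N) g01) _.
have := layer_cake_le nu mg (ltn0Sn _ : (0 < K)%N) g01.
suff : K%:R^-1 * (\sum_(j < K) prob (P N) (A j)) <=
    K%:R^-1 * (\sum_(j < K) prob nu (A j)) + e / 2.
  rewrite /A; lra.
have -> : e / 2 = K%:R^-1 * \sum_(j < K) (e / 2).
  by rewrite sumr_const card_ord -(mulr_natl (e / 2) K) mulKf// pnatr_eq0.
by rewrite -mulrDr ler_pM2l ?invr_gt0 ?ltr0n// -big_split/=; exact: ler_sum.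
Qed.

Let upper_bounded f (M : R) : 0 < M -> continuous f -> (forall x, `|f x| <= M) ->
  forall e : R, 0 < e -> \forall N \near U, \int[P N]_x f x <= \int[nu]_x f x + e.
Proof.
move=> M0 cf fM e e0.
pose g x := (2 * M)^-1 * (f x + M).
have cg : continuous g.
  move=> x; apply: cvgMr; apply: cvgD; first exact: cf.
  exact: cvg_cst.
have M2 : 0 < 2 * M by rewrite mulr_gt0.
have g01 x : 0 <= g x <= 1.
  have := fM x; rewrite ler_norml => /andP[f1 f2].
  apply/andP; split.
    by rewrite /g mulr_ge0// ?invr_ge0 ?(ltW M2)// -lerBlDr sub0r.
  by rewrite /g mulrC ler_pdivrMr// mul1r; lra.
have int_f (mu : probability (borel X) R) :
    \int[mu]_x f x = 2 * M * (\int[mu]_x g x) - M.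
  rewrite -RintegralZl//; last exact: continuous_integrable.
  have cM : \int[mu]_x M = M.
    by rewrite Rintegral_cst// -/(prob mu setT) probT mulr1.
  rewrite -[X in _ - X]cM.
  rewrite -RintegralB//; last 2 first.
  - apply: (@bounded_integrable mu _ (2 * M)).
      by apply: measurable_funM => //; exact: continuous_borel.
    move=> x; have /andP[g0 g1] := g01 x.
    rewrite (ger0_norm (mulr_ge0 (ltW M2) g0)).
    exact: ler_piMr (ltW M2) g1.
  - exact: finite_measure_integrable_cst.
  apply: eq_Rintegral => x _.
  by rewrite /g mulVKf ?gt_eqF// addrK.
have e2 : 0 < e / (2 * M) by rewrite divr_gt0.
apply: filterS (upper cg g01 e2) => N HN; rewrite !int_f.
rewrite addrAC lerD2r -lerBlDl -mulrBr mulrC -ler_pdivlMr//.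
by rewrite lerBlDl.
Qed.

(** The hypothesis on closed sets is one-sided, so the upper bound is applied to [f] and to
    [- f]. *)
Lemma portmanteau f : continuous f ->
  \int[P N]_x f x @[N --> U] --> \int[nu]_x f x.
Proof.
move=> cf; have [M [M0 fM]] := continuous_bounded cptX cf.
have int_N (mu : probability (borel X) R) : \int[mu]_x (- f x) = - \int[mu]_x f x.
  rewrite -[RHS]mulN1r -RintegralZl//; last exact: continuous_integrable.
  by apply: eq_Rintegral => x _; rewrite mulN1r.
apply/cvgrPdist_le => e e0; near=> N.
have up : \int[P N]_x f x <= \int[nu]_x f x + e.
  by near: N; exact: (upper_bounded M0 cf fM).
have lo : \int[P N]_x (- f x) <= \int[nu]_x (- f x) + e.
  near: N; apply: (upper_bounded M0) => //.
    by move=> x; apply: cvgN; exact: cf.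
  by move=> x; rewrite normrN.
rewrite !int_N in lo; rewrite ler_norml; lra.
Unshelve. all: by end_near. Qed.

End portmanteau.

End borel_integrals.

Lemma pointwise_cvg (I : Type) (V : topologicalType) (F : set_system (I -> V))
    (f : I -> V) : Filter F ->
  (forall i, g i @[g --> F] --> f i) -> F --> (f : {ptws I -> V}).
Proof.
move=> FF H; apply/cvg_sup => i A; rewrite nbhsE => -[B [[C oC <-] Cf] BA].
apply: filterS BA _; apply: H; exact: open_nbhs_nbhs.
Qed.

Section weak_topology_lemmas.
Context {R : realType} {X : pointedMetricType R}.

Lemma weak_cvg (F : set_system (weak_probability X)) (nu : weak_probability X) :
  Filter F ->
  (forall f : continuousType X R,
    integrals mu f @[mu --> F] --> integrals nu f) -> F --> nu.
Proof.
move=> FF H A; rewrite nbhsE => -[B [[C oC <-] Cf] BA].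
apply: filterS BA _.
have := @pointwise_cvg _ R (integrals @ F) (integrals nu) _ H.
by apply; exact: open_nbhs_nbhs.
Qed.

Lemma weak_integral_continuous (f : continuousType X R) :
  continuous (fun mu : weak_probability X => integrals mu f).
Proof.
move=> nu; have c1 : integrals @ nu --> (integrals nu : {ptws continuousType X R -> R}).
  exact: initial_continuous.
have /cvg_sup/(_ f) c2 := c1.
move=> A hA; apply: (c2 _ (fun h => A (h f))).
  apply: fmap_filter; exact: (nbhs_filter (nu : weak_probability X)).
exact: (@initial_continuous _ R (fun h : continuousType X R -> R => h f)).
Qed.

(** A cluster point only gives approximations at some times, so two functions are treated together
    to get a common [N]; they will be [f] and [f \o T]. *)
Lemma weak_cluster_integral (P : nat -> weak_probability X) (nu : weak_probability X)
    (f g : X -> R) (e : R) N0 :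
  cluster (P @ \oo) nu -> continuous f -> continuous g -> 0 < e ->
  exists N, [/\ (N0 <= N)%N,
    `|\int[nu : probability (borel X) R]_x f x -
      \int[P N : probability (borel X) R]_x f x| < e &
    `|\int[nu : probability (borel X) R]_x g x -
      \int[P N : probability (borel X) R]_x g x| < e].
Proof.
move=> clnu cf cg e0.
pose cF : continuousType X R := HB.pack f (isContinuous.Build _ _ f cf).
pose cG : continuousType X R := HB.pack g (isContinuous.Build _ _ g cg).
have nf : nbhs nu [set mu | `|integrals nu cF - integrals mu cF| < e].
  have /cvgrPdist_lt/(_ e e0) := @weak_integral_continuous cF nu.
  by rewrite near_simpl.
have ng : nbhs nu [set mu | `|integrals nu cG - integrals mu cG| < e].
  have /cvgrPdist_lt/(_ e e0) := @weak_integral_continuous cG nu.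
  by rewrite near_simpl.
have PN : (P @ \oo) (P @` [set N | (N0 <= N)%N]).
  by exists N0 => // N /= N0N; exists N.
have [_ [[N /= N0N <-] [HF HG]]] := clnu _ _ PN (filterI nf ng).
by exists N; split.
Qed.

End weak_topology_lemmas.

Section empirical_lemmas.
Context {R : realType} {X : pointedMetricType R}.
Variables (T : X -> X) (x : X) (N : nat).

Definition orbit_avg (g : X -> R) : R :=
  N.+1%:R^-1 * \sum_(n < N.+1) g (iter n.+1 T x).

Lemma empirical_prob (A : set X) :
  prob (empirical_probability T x N) A = orbit_avg (\1_A).
Proof.
rewrite /prob /empirical_probability /= /empirical /mscale /= /msum /orbit_avg.
by rewrite (eq_bigr (fun i : 'I_N.+1 => (\1_A (iter i.+1 T x))%:E)) ?sumEFin//.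
Qed.

Let ge0_empirical_integral (g : X -> R) : measurable_fun [set: borel X] g ->
  (forall y, 0 <= g y) ->
  \int[empirical_probability T x N : probability (borel X) R]_y g y = orbit_avg g.
Proof.
move=> mg g0; have mG : measurable_fun [set: borel X] (EFin \o g).
  exact/measurable_EFinP.
rewrite /Rintegral /= /empirical ge0_integral_mscale//=; last first.
  by move=> y _; rewrite lee_fin.
rewrite ge0_integral_measure_sum//; last by move=> y _; rewrite lee_fin.
under eq_bigr do rewrite integral_dirac// diracT mul1e.
by rewrite sumEFin.
Qed.

Lemma empirical_integral (g : X -> R) (M : R) : measurable_fun [set: borel X] g ->
  (forall y, `|g y| <= M) ->
  \int[empirical_probability T x N : probability (borel X) R]_y g y = orbit_avg g.
Proof.
move=> mg gM; set mu : probability (borel X) R := empirical_probability T x N.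
(* Adding [M] reduces to nonnegative functions, for which the integral splits over the sum of Dirac
   masses. *)
have h0 y : 0 <= g y + M by have := gM y; rewrite ler_norml; lra.
have mh : measurable_fun [set: borel X] (fun y => g y + M).
  exact: measurable_funD.
have := ge0_empirical_integral mh h0.
rewrite RintegralD//; last 2 first.
- exact: (bounded_integrable mu mg gM).
- exact: finite_measure_integrable_cst.
rewrite Rintegral_cst// -/(prob mu setT) probT mulr1 /orbit_avg.
rewrite big_split/= sumr_const card_ord -(mulr_natl M N.+1) mulrDr mulKf ?pnatr_eq0//.
by move/addIr.
Qed.

End empirical_lemmas.

Section measure_determined_by_integrals.
Context {R : realType} {X : pointedMetricType R}.
Implicit Types (mu : probability (borel X) R) (F : set X).

Definition thickening F k : set X := setdist F @^-1` [set t | t < k.+1%:R^-1].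

Lemma open_thickening F k : open (thickening F k).
Proof.
apply: open_comp; last exact: open_lt.
by move=> x _; exact: setdist_continuous.
Qed.

Lemma bigcap_thickening F : F !=set0 -> closed F -> \bigcap_k thickening F k = F.
Proof.
move=> F0 cF; apply/seteqP; split => [x Hx|x Fx k _]; last first.
  by rewrite /thickening/= setdist_in// invr_gt0.
apply: contrapT => nFx; have d0 := setdist_gt0 F0 cF nFx.
have := Hx (Num.truncn (setdist F x)^-1) I; rewrite /thickening/= ltNge => /negP; apply.
rewrite -[leRHS]invrK lef_pV2 ?posrE ?invr_gt0//.
by rewrite ltW// truncnS_gt.
Qed.

Lemma prob_thickening mu F : F !=set0 -> closed F ->
  prob mu (thickening F k) @[k --> \oo] --> prob mu F.
Proof.
move=> F0 cF; have mk k : measurable (thickening F k : set (borel X)).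
  by apply: open_borel; exact: open_thickening.
have := @nonincreasing_cvg_mu _ (borel X) R mu (thickening F).
rewrite bigcap_thickening// => /(_ _ mk (closed_borel cF)) H.
have {}H : (mu \o thickening F) x @[x --> \oo] --> mu F.
  apply: H; first by rewrite ltey_eq fin_num_measure.
  move=> n m nm; rewrite subsetEset => x /lt_le_trans; apply.
  by rewrite lef_pV2 ?posrE// ler_nat.
by apply: fine_cvg; rewrite -/(prob mu F) -probE//; exact: closed_borel.
Qed.

Lemma thickening_function F k : exists f : X -> R, [/\ continuous f,
  forall x, \1_F x <= f x & forall x, f x <= \1_(thickening F k) x].
Proof.
exists (fun x => Num.max 0 (1 - k.+1%:R * setdist F x)); split.
- move=> x; apply: (@continuous_max _ X (fun=> 0)
    (fun x => 1 - k.+1%:R * setdist F x)); first exact: cvg_cst.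
  apply: cvgB; first exact: cvg_cst.
  apply: cvgMr; exact: setdist_continuous.
- move=> x; rewrite indicE; case: (boolP (x \in F)) => [|_].
    by rewrite inE => /setdist_in ->; rewrite mulr0 subr0 le_max lexx orbT.
  by rewrite le_max lexx.
- move=> x; rewrite indicE; case: (boolP (x \in thickening F k)) => [_|].
    rewrite ge_max ler01 lerBlDr lerDl mulr_ge0//; exact: setdist_ge0.
  rewrite notin_setE /thickening/= => /negP; rewrite -leNgt => h.
  by rewrite ge_max lexx subr_le0 mulrC -ler_pdivrMr ?ltr0n// mul1r.
Qed.

(** A continuous function fits between the indicators of [F] and of a thickening of [F], and the
    thickenings decrease to [F]. *)
Lemma closed_prob_le mu1 mu2 F : closed F ->
  (forall f, continuous f -> \int[mu1]_x f x = \int[mu2]_x f x) ->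
  prob mu1 F <= prob mu2 F.
Proof.
move=> cF H; have [->|/set0P F0] := eqVneq F set0; first by rewrite /prob !measure0.
apply/ler_addgt0Pr => e e0.
have /cvgrPdist_lt/(_ e e0)[k _ /(_ k (leqnn k))] := @prob_thickening mu2 F F0 cF.
move=> /= hk; have [f [cf f1 f2]] := thickening_function F k.
have mf := continuous_borel cf.
have ind01 (A : set X) x : 0 <= (\1_A x : R) <= 1.
  by rewrite indicE; case: (x \in A); rewrite ?lexx ?ler01.
have fb x : `|f x| <= 1.
  have := f1 x; have := f2 x; have /andP[? ?] := ind01 F x.
  by have /andP[? ?] := ind01 (thickening F k) x; rewrite ler_norml; lra.
have mF := closed_borel cF.
have mk : measurable (thickening F k : set (borel X)).
  by apply: open_borel; exact: open_thickening.
have ind1 (A : set X) x : `|\1_A x : R| <= 1.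
  by have /andP[? ?] := ind01 A x; rewrite ger0_norm.
have h1 : prob mu1 F <= \int[mu1]_x f x.
  rewrite -Rintegral_indic//; apply: le_Rintegral => //.
    apply: (bounded_integrable mu1 _ (ind1 F)); exact: measurable_indic.
  exact: (bounded_integrable mu1 mf fb).
have h2 : \int[mu2]_x f x <= prob mu2 (thickening F k).
  rewrite -Rintegral_indic//; apply: le_Rintegral => //.
    exact: (bounded_integrable mu2 mf fb).
  apply: (bounded_integrable mu2 _ (ind1 _)); exact: measurable_indic.
move: hk; rewrite ltr_norml; have := H f cf; lra.
Qed.

(** Closed sets, hence open sets, have equal measure; the open sets are stable under intersection
    and generate the Borel sets. *)
Lemma eq_prob mu1 mu2 :
  (forall f, continuous f -> \int[mu1]_x f x = \int[mu2]_x f x) ->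
  forall A, measurable (A : set (borel X)) -> mu1 A = mu2 A.
Proof.
move=> H; have eqc F : closed F -> prob mu1 F = prob mu2 F.
  move=> cF; apply/eqP; rewrite eq_le !closed_prob_le// => f cf.
  by rewrite H.
apply: (@measure_unique _ R (borel X) open (fun=> setT)) => //.
- by move=> A B oA oB; exact: openI.
- by move=> _; exact: openT.
- by rewrite bigcup_const.
- move=> A oA; have mA := open_borel oA.
  have /eqc : closed (~` A) by exact: open_closedC.
  rewrite !probC// => eqA; transitivity (prob mu1 A)%:E; first exact: probE.
  have -> : prob mu1 A = prob mu2 A by lra.
  by apply/esym; exact: probE.
- by move=> _; rewrite [ltLHS]probability_setT ltry.
Qed.

End measure_determined_by_integrals.


(** * Invariance of the accumulation points of empirical measures *)

Section invariance.
Context {R : realType} {X : pointedMetricType R}.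
Variables (T : X -> X) (x : X) (nu : weak_probability X).
Hypotheses (cptX : compact [set: X]) (cT : continuous T).
Hypothesis clnu : cluster (empirical_probability T x @ \oo) nu.

Let mu : probability (borel X) R := nu.

Let mT : measurable_fun [set: borel X] (T : borel X -> borel X).
Proof.
apply: (@measurability _ _ (borel X) (borel X) setT T (@open X)) => //.
move=> _ [A oA <-]; rewrite setTI; apply: open_borel.
by move/continuousP: cT; apply.
Qed.

(** The difference telescopes to one boundary term at each end, each of size at most [M]. *)
Lemma orbit_avg_shift N (g : X -> R) M : (forall y, `|g y| <= M) ->
  `|orbit_avg T x N (g \o T) - orbit_avg T x N g| <= 2 * M / N.+1%:R.
Proof.
move=> gM; rewrite /orbit_avg -mulrBr -sumrB.
pose h n := g (iter n.+1 T x).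
rewrite -(big_mkord xpredT (fun n => h n.+1 - h n)) telescope_sumr//.
rewrite normrM ger0_norm ?invr_ge0// mulrC ler_wpM2r ?invr_ge0//.
rewrite (le_trans (ler_normB _ _))//.
by have := gM (iter N.+2 T x); have := gM (iter 1 T x); rewrite /h; lra.
Qed.

Let integral_invariant f : continuous f -> \int[mu]_x f (T x) = \int[mu]_x f x.
Proof.
move=> cf; have [M [M0 fM]] := continuous_bounded cptX cf.
have cfT : continuous (f \o T).
  by move=> y; apply: continuous_comp; [exact: cT|exact: cf].
apply/eqP; rewrite -subr_eq0 -normr_le0; apply/ler_addgt0Pr => e e0.
have e3 : 0 < e / 3 by rewrite divr_gt0.
(* From [N0] on the boundary terms weigh at most [e / 3]; the other two thirds are the
   approximations of the two integrals. *)
pose N0 := Num.truncn (2 * M / (e / 3)).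
have [N [N0N h1 h2]] := weak_cluster_integral N0 clnu cf cfT e3.
have fTM y : `|f (T y)| <= M by [].
move: h1 h2.
rewrite (empirical_integral T x N (continuous_borel cf) fM).
rewrite (empirical_integral T x N (continuous_borel cfT) fTM).
have := orbit_avg_shift N fM.
have : 2 * M / N.+1%:R <= e / 3.
  rewrite ler_pdivrMr ?ltr0n// [leRHS]mulrC -ler_pdivrMr//.
  by apply: le_trans (ltW (truncnS_gt _)) _; rewrite ler_nat ltnS.
rewrite add0r /mu !ltr_norml !ler_norml /=.
set c := 2 * M / _; set a := Rintegral _ _ _; set b := Rintegral _ _ _.
move: (orbit_avg _ _ _ _) (orbit_avg _ _ _ _) a b c => u v a b c; lra.
Qed.

Lemma cluster_invariant A : measurable (A : set (borel X)) ->
  mu (T @^-1` A) = mu A.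
Proof.
pose Tm : {mfun borel X >-> borel X} := HB.pack (T : borel X -> borel X)
  (isMeasurableFun.Build _ _ _ _ _ mT).
move=> mA; rewrite -[LHS]/(distribution mu Tm A).
apply: (@eq_prob _ _ (distribution mu Tm) mu) => // f cf.
rewrite -integral_invariant//.
rewrite /Rintegral integral_pushforward//.
  by apply/measurable_EFinP; exact: continuous_borel.
apply: continuous_integrable => // y.
by apply: continuous_comp; [exact: cT|exact: cf].
Qed.

End invariance.

(** * Entropy of partitions *)

Lemma limn_esup_le {R : realType} (u : (\bar R)^nat) (c : \bar R) :
  (\forall n \near \oo, (u n <= c)%E) -> (limn_esup u <= c)%E.
Proof.
move=> H; apply: ge_ereal_inf; exists (ereal_sup (u @` [set n | (u n <= c)%E])).
  by exists [set n | (u n <= c)%E].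
by apply: ge_ereal_sup => _ [n /= un <-].
Qed.

Lemma limn_esup_lt {R : realType} (u : (\bar R)^nat) (c : \bar R) :
  (limn_esup u < c)%E -> \forall n \near \oo, (u n < c)%E.
Proof.
move=> /ereal_inf_lt[_ [A FA <-] Ac]; apply: filterS FA => n An.
by apply: le_lt_trans Ac; apply: ereal_sup_ubound; exists n.
Qed.

(** This is [ln t <= t - 1] at [t = q / p]. The last hypothesis excludes [q = 0 < p], where the
    default value [ln 0 = 0] could break the inequality. *)
Lemma gibbs_term {R : realType} (p q : R) : 0 <= p -> 0 <= q ->
  (q = 0 -> p = 0) -> p * ln q - p * ln p <= q - p.
Proof.
move=> p0 q0 qp; have [->|pn0] := eqVneq p 0; first by rewrite !mul0r; lra.
have pp : 0 < p by rewrite lt_neqAle eq_sym pn0.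
have qq : 0 < q.
  by rewrite lt_neqAle q0 andbT; apply/eqP => /esym/qp/eqP; rewrite (negbTE pn0).
have -> : q - p = p * (q / p - 1) by rewrite mulrBr mulr1 mulrC divfK.
rewrite -mulrBr ler_pM2l// -lnV ?posrE// -lnM ?posrE ?invr_gt0//.
have := @le_ln1Dx R (q / p - 1); rewrite [1 + _]addrC subrK; apply.
by rewrite ltrBrDl subrr divr_gt0.
Qed.

Section partition_entropy_theory.
Context d {X : measurableType d} {R : realType}.
Variable mu : probability X R.
Local Notation H := (partition_entropy mu).
Local Notation pr A := (fine (mu A)).

Lemma fin_partition_measurable (I : finType) (xi : X -> I) (P : pred I) :
  measurable_partition xi -> measurable [set x | P (xi x)].
Proof.
move=> mxi; have -> : [set x | P (xi x)] =
    \big[setU/set0]_(i <- enum P) (xi @^-1` [set i]).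
  apply/seteqP; split => x.
    move=> /= Px; rewrite -bigcup_seq; exists (xi x) => //=.
    by rewrite mem_enum.
  by rewrite -bigcup_seq => -[i /= + e]; rewrite mem_enum e.
exact: bigsetU_measurable.
Qed.

Lemma fine_measureU (A B : set X) : measurable A -> measurable B ->
  A `&` B = set0 -> pr (A `|` B) = pr A + pr B.
Proof.
move=> mA mB AB; rewrite [X in fine X](measureU mu mA mB AB) fineD//;
  exact: fin_num_measure.
Qed.

Lemma fine_measure_le (A B : set X) : measurable A -> measurable B ->
  A `<=` B -> pr A <= pr B.
Proof.
move=> mA mB AB; apply: fine_le; [exact: fin_num_measure..|].
by apply: le_measure; rewrite ?inE.
Qed.

Lemma fine_measure_ge0 (A : set X) : 0 <= pr A.
Proof. exact: fine_ge0. Qed.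

Lemma prob_partition (I : finType) (xi : X -> I) (P : pred I) :
  measurable_partition xi ->
  pr [set x | P (xi x)] = \sum_(i | P i) pr (xi @^-1` [set i]).
Proof.
move=> mxi; transitivity (\sum_(i <- enum P) pr (xi @^-1` [set i])); last first.
  by rewrite big_enum.
have -> : [set x | P (xi x)] = [set x | xi x \in enum P].
  by apply/seteqP; split => x /=; rewrite mem_enum.
move: (enum_uniq P); elim: (enum P) => [|i s IH] /=.
  move=> _; rewrite big_nil (_ : [set x | _] = set0) ?measure0//.
  by rewrite -subset0.
move=> /andP[si /IH {}IH]; rewrite big_cons -IH -fine_measureU//.
- congr (pr _); apply/seteqP; split => x /=; rewrite inE.
    by move=> /orP[/eqP|]; [left|right].
  by move=> [->|->]; rewrite ?eqxx ?orbT.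
- exact: (fin_partition_measurable (fun i => i \in s) mxi).
- by rewrite -subset0 => x /= [->]; rewrite (negbTE si).
Qed.

Lemma prob_partitionT (I : finType) (xi : X -> I) : measurable_partition xi ->
  \sum_i pr (xi @^-1` [set i]) = 1.
Proof.
move=> mxi; rewrite -(prob_partition xpredT mxi).
rewrite (_ : [set x | _] = setT) ?probability_setT//.
by apply/seteqP; split.
Qed.

Lemma measurable_partition_comp (I J : finType) (f : I -> J) (xi : X -> I) :
  measurable_partition xi -> measurable_partition (f \o xi).
Proof.
move=> mxi j; rewrite (_ : _ @^-1` _ = [set x | f (xi x) == j]).
  exact: (fin_partition_measurable (fun i => f i == j) mxi).
by apply/seteqP; split => x /=; [move=> ->|move/eqP].
Qed.

Lemma sum_partition_comp (I J : finType) (f : I -> J) (xi : X -> I) (G : J -> R) :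
  measurable_partition xi ->
  \sum_j pr ((f \o xi) @^-1` [set j]) * G j =
  \sum_i pr (xi @^-1` [set i]) * G (f i).
Proof.
move=> mxi; rewrite [RHS](partition_big f xpredT)//=; apply: eq_bigr => j _.
rewrite (_ : _ @^-1` _ = [set x | f (xi x) == j]); last first.
  by apply/seteqP; split => x /=; [move=> ->|move/eqP].
rewrite (prob_partition (fun i => f i == j) mxi) mulr_suml.
by apply: eq_bigr => i /eqP <-.
Qed.

(** Gibbs' inequality. Bounds below come from a choice of [q]: uniform for the number of labels, a
    product of marginals for subadditivity, weight concentrated on one label for
    [rare_labels_entropy]. *)
Lemma partition_entropy_le_cross (I : finType) (xi : X -> I) (q : I -> R) :
  measurable_partition xi -> (forall i, 0 <= q i) -> \sum_i q i <= 1 ->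
  (forall i, q i = 0 -> pr (xi @^-1` [set i]) = 0) ->
  H xi <= - \sum_i pr (xi @^-1` [set i]) * ln (q i).
Proof.
move=> mxi q0 q1 qp; rewrite /partition_entropy -subr_le0 opprK addrC.
rewrite -sumrB (le_trans (ler_sum _ (fun i _ => gibbs_term _ _ (qp i))))//.
  by move=> i _; exact: fine_measure_ge0.
by rewrite sumrB prob_partitionT// subr_le0.
Qed.

Lemma partition_entropy_ge0 (I : finType) (xi : X -> I) :
  measurable_partition xi -> 0 <= H xi.
Proof.
move=> mxi; rewrite /partition_entropy -sumrN sumr_ge0// => i _.
rewrite -mulrN mulr_ge0 ?fine_measure_ge0// oppr_ge0 ln_le0//.
rewrite -(prob_partitionT mxi) (bigD1 i)//= lerDl sumr_ge0// => j _.
exact: fine_measure_ge0.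
Qed.

Lemma partition_entropy_le_card (I : finType) (xi : X -> I) :
  measurable_partition xi -> (0 < #|I|)%N -> H xi <= ln #|I|%:R.
Proof.
move=> mxi I0; have c0 : 0 < #|I|%:R :> R by rewrite ltr0n.
apply: le_trans (@partition_entropy_le_cross _ xi (fun=> #|I|%:R^-1) mxi _ _ _) _.
- by move=> i; rewrite invr_ge0.
- by rewrite sumr_const -[X in X <= 1]mulr_natl mulfV// gt_eqF.
- by move=> i /eqP; rewrite invr_eq0 gt_eqF.
by rewrite -mulr_suml prob_partitionT// mul1r lnV ?posrE// opprK.
Qed.

Lemma partition_entropy_comp_le (I J : finType) (f : I -> J) (xi : X -> I) :
  measurable_partition xi -> H (f \o xi) <= H xi.
Proof.
move=> mxi; rewrite /partition_entropy lerN2.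
rewrite (sum_partition_comp f (fun j => ln (pr ((f \o xi) @^-1` [set j]))) mxi).
apply: ler_sum => i _; have := fine_measure_ge0 (xi @^-1` [set i]).
rewrite le_eqVlt => /orP[/eqP <-|p0]; first by rewrite !mul0r.
have le : pr (xi @^-1` [set i]) <= pr ((f \o xi) @^-1` [set f i]).
  apply: fine_measure_le => //; first exact: measurable_partition_comp.
  by move=> x /= ->.
by rewrite ler_pM2l// ler_ln ?posrE//; exact: lt_le_trans le.
Qed.

Definition partition_pair (I J : finType) (xi : X -> I) (eta : X -> J) x :=
  (xi x, eta x).

Lemma measurable_partition_pair (I J : finType) (xi : X -> I) (eta : X -> J) :
  measurable_partition xi -> measurable_partition eta ->
  measurable_partition (partition_pair xi eta).
Proof.
move=> mxi meta [i j].
rewrite (_ : _ @^-1` _ = xi @^-1` [set i] `&` eta @^-1` [set j]).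
  exact: measurableI.
by apply/seteqP; split => x; rewrite /preimage /partition_pair /= => -[-> ->].
Qed.

Lemma partition_entropy_pair_le (I J : finType) (xi : X -> I) (eta : X -> J) :
  measurable_partition xi -> measurable_partition eta ->
  H (partition_pair xi eta) <= H xi + H eta.
Proof.
move=> mxi meta; set zeta := partition_pair xi eta.
have mz : measurable_partition zeta by exact: measurable_partition_pair.
pose p i := pr (xi @^-1` [set i]); pose q j := pr (eta @^-1` [set j]).
have zp u : pr (zeta @^-1` [set u]) <= p u.1.
  by apply: fine_measure_le => // x /= <-.
have zq u : pr (zeta @^-1` [set u]) <= q u.2.
  by apply: fine_measure_le => // x /= <-.
have z0 u := fine_measure_ge0 (zeta @^-1` [set u]).
apply: le_trans (@partition_entropy_le_cross _ zeta (fun u => p u.1 * q u.2) mz _ _ _) _.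
- by move=> u; rewrite mulr_ge0// fine_measure_ge0.
- rewrite -(pair_bigA _ (fun i j => p i * q j))/=.
  under eq_bigr do rewrite -mulr_sumr prob_partitionT// mulr1.
  by rewrite prob_partitionT.
- move=> u /eqP; rewrite mulf_eq0 => /orP[] /eqP e0; apply/eqP.
    by rewrite eq_le z0 andbT -e0 zp.
  by rewrite eq_le z0 andbT -e0 zq.
have e1 : H xi = - \sum_u pr (zeta @^-1` [set u]) * ln (p u.1).
  by rewrite -(sum_partition_comp fst (fun i => ln (p i)) mz).
have e2 : H eta = - \sum_u pr (zeta @^-1` [set u]) * ln (q u.2).
  by rewrite -(sum_partition_comp snd (fun i => ln (q i)) mz).
rewrite e1 e2 -opprD lerN2 -big_split/=; apply: ler_sum => u _.
have := z0 u; rewrite le_eqVlt => /orP[/eqP <-|zu]; first by rewrite !mul0r addr0.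
by rewrite lnM ?posrE ?mulrDr//; [exact: lt_le_trans (zp u)|exact: lt_le_trans (zq u)].
Qed.

Section joins.
Variables (T : X -> X) (I : finType) (xi : X -> I).
Hypothesis mT : forall A, measurable A -> measurable (T @^-1` A).
Hypothesis inv : forall A, measurable A -> mu (T @^-1` A) = mu A.
Hypothesis mxi : measurable_partition xi.

Lemma measurable_iter n (A : set X) : measurable A -> measurable (iter n T @^-1` A).
Proof.
move=> mA; elim: n => [//|n IH].
rewrite (_ : _ @^-1` _ = T @^-1` (iter n T @^-1` A)); first exact: mT.
by apply/seteqP; split => x /=; rewrite -iterSr.
Qed.

Lemma measure_iter n (A : set X) : measurable A -> mu (iter n T @^-1` A) = mu A.
Proof.
move=> mA; elim: n => [//|n <-]; rewrite -(inv (measurable_iter n mA)).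
by congr (mu _); apply/seteqP; split => x /=; rewrite -iterSr.
Qed.

Let ext n (u : {ffun 'I_n -> I} * I) : {ffun 'I_n.+1 -> I} :=
  [ffun k => if unlift ord_max k is Some k' then u.1 k' else u.2].

Let joinS n : partition_join T xi n.+1 =
  @ext n \o partition_pair (partition_join T xi n) (xi \o iter n T).
Proof.
apply/funext => x; apply/ffunP => k; rewrite /= !ffunE.
case: unliftP => [k' ->|->//].
by rewrite lift_max ffunE.
Qed.

Let miter n : measurable_partition (xi \o iter n T).
Proof. by move=> i; exact: (measurable_iter n (mxi i)). Qed.

Lemma measurable_partition_join n : measurable_partition (partition_join T xi n).
Proof.
elim: n => [w|n IH].
  rewrite (_ : _ @^-1` _ = setT)//; apply/seteqP; split => x //= _.
  by apply/ffunP => -[].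
rewrite joinS; apply: measurable_partition_comp.
by apply: measurable_partition_pair; [exact: IH|exact: miter].
Qed.

Lemma partition_entropy_join_le n : H (partition_join T xi n) <= n%:R * H xi.
Proof.
elim: n => [|n IH].
  rewrite mul0r; apply: le_trans (partition_entropy_le_card _ _) _.
  - exact: measurable_partition_join.
  - by rewrite card_ffun card_ord expn0.
  - by rewrite card_ffun card_ord expn0 ln1.
rewrite joinS; apply: le_trans (partition_entropy_comp_le _ _) _.
  apply: measurable_partition_pair; last exact: miter.
  exact: measurable_partition_join.
have mjn := @measurable_partition_join n.
have h := partition_entropy_pair_le mjn (@miter n).
apply: le_trans h _.
rewrite mulrSr mulrDl mul1r lerD//.
rewrite /partition_entropy le_eqVlt; apply/orP; left; apply/eqP; congr (- _).
by apply: eq_bigr => i _; rewrite (measure_iter n (mxi i)).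
Qed.

End joins.
End partition_entropy_theory.

(** * Regularity of Borel probability measures *)

Section regularity.
Context {R : realType} {X : pointedMetricType R}.
Variable mu : probability (borel X) R.

Definition regular_set (A : set X) := forall e : R, 0 < e -> exists F G : set X,
  [/\ closed F, open G, F `<=` A, A `<=` G & (mu (G `\` F) <= e%:E)%E].

Let open_regular (A : set X) : open A -> regular_set A.
Proof.
move=> oA e e0; have [A'0|/set0P A'0] := eqVneq (~` A) set0.
  exists A, A; split => //; last by rewrite setDv measure0 lee_fin ltW.
  by rewrite -(setCK A) A'0 setC0; exact: closedT.
have cA : closed (~` A) by exact: open_closedC.
have /cvgrPdist_lt/(_ e e0)[k _ /(_ k (leqnn k))] := @prob_thickening _ _ mu _ A'0 cA.
have ok := open_thickening (~` A) k.
move=> /= hk; exists (~` thickening (~` A) k), A; split => //.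
- exact: open_closedC.
- move=> x nx; apply: contrapT => nAx; apply: nx.
  by rewrite /thickening/= setdist_in// invr_gt0.
have mA := open_borel oA; have mk := open_borel ok.
rewrite (_ : A `\` _ = thickening (~` A) k `\` ~` A); last first.
  by rewrite !setDE !setCK setIC.
have mD : measurable (thickening (~` A) k `\` ~` A : set (borel X)).
  by apply: measurableD => //; exact: closed_borel.
rewrite probE// lee_fin.
have : prob mu (thickening (~` A) k) =
    prob mu (thickening (~` A) k `\` ~` A) + prob mu (~` A).
  rewrite -fine_measureU//; last 2 first.
  - exact: closed_borel.
  - by rewrite setDE -setIA setICl setI0.
  congr (fine (mu _)); apply/seteqP; split => x.
    by move=> hx; have [Ax|nAx] := pselect (A x); [left; split => // -[]|right].
  move=> [[]//|nAx]; by rewrite /thickening/= setdist_in// invr_gt0.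
by move: hk; rewrite ltr_norml; lra.
Qed.

Let setC_regular (A : set X) : regular_set A -> regular_set (~` A).
Proof.
move=> rA e /rA[F [G [cF oG FA AG GF]]]; exists (~` G), (~` F); split.
- exact: open_closedC.
- exact: closed_openC.
- exact: subsetC.
- exact: subsetC.
by rewrite (_ : _ `\` _ = G `\` F)// !setDE setCK setIC.
Qed.

(** The errors of the separate sets sum to [e / 2]. An infinite union of closed sets need not be
    closed, so only [F 0] to [F N] are kept, and the other [e / 2] pays for the tail. *)
Let bigcup_regular (A : (set X)^nat) : (forall n, regular_set (A n)) ->
  regular_set (\bigcup_n A n).
Proof.
move=> rA e e0; have e2 : 0 < e / 2 by rewrite divr_gt0.
have e2n n : 0 < e / 2 / (2 ^ n.+1)%:R by rewrite divr_gt0// ltr0n expn_gt0.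
have /choice[FG HFG] : forall n, exists FG : set X * set X,
    [/\ closed FG.1, open FG.2, FG.1 `<=` A n, A n `<=` FG.2 &
      (mu (FG.2 `\` FG.1) <= (e / 2 / (2 ^ n.+1)%:R)%:E)%E].
  by move=> n; have [F [G h]] := rA n _ (e2n n); exists (F, G).
pose F n := (FG n).1; pose G n := (FG n).2.
have mF n : measurable (F n : set (borel X)).
  by apply: closed_borel; have [] := HFG n.
have mG n : measurable (G n : set (borel X)).
  by apply: open_borel; have [] := HFG n.
pose B N : set X := \big[setU/set0]_(i < N.+1) F i.
have mB N : measurable (B N : set (borel X)) by exact: bigsetU_measurable.
have mUF : measurable (\bigcup_n F n : set (borel X)) by exact: bigcup_measurable.
have mUG : measurable (\bigcup_n G n : set (borel X)) by exact: bigcup_measurable.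
have ndB : {homo B : n m / (n <= m)%N >-> (n <= m)%O}.
  by move=> n m nm; rewrite subsetEset; apply: subset_bigsetU.
have UB : \bigcup_n B n = \bigcup_n F n.
  exact: bigcup_bigsetU_bigcup.
have := nondecreasing_cvg_mu (mu := mu) mB _ ndB.
rewrite UB => /(_ mUF) cvgB.
have {}cvgB : prob mu (B n) @[n --> \oo] --> prob mu (\bigcup_n F n).
  by apply: fine_cvg; rewrite -/(prob mu _) -probE.
have /cvgrPdist_lt/(_ _ e2)[N _ /(_ N (leqnn N))/= hN] := cvgB.
exists (B N), (\bigcup_n G n); split.
- rewrite /B -bigcup_mkord; apply: closed_bigcup => //.
  by move=> i _; have [] := HFG i.
- by apply: bigcup_open => i _; have [] := HFG i.
- rewrite /B -bigcup_mkord => x [i _ Fix]; exists i => //.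
  by have [_ _ + _ _] := HFG i; apply.
- by move=> x [i _ Aix]; exists i => //; have [_ _ _ + _] := HFG i; apply.
apply: (@le_trans _ _ (mu ((\bigcup_n G n `\` \bigcup_n F n) `|`
    (\bigcup_n F n `\` B N)))).
  apply: le_measure; rewrite ?inE.
  - exact: measurableD.
  - by apply: measurableU; exact: measurableD.
  - move=> x [Gx nB]; have [Fx|nF] := pselect ((\bigcup_n F n) x); [by right|by left].
apply: (le_trans (measureU2 _ _ _)); [exact: measurableD..|].
rewrite [leRHS](_ : _ = (e / 2)%:E + (e / 2)%:E)%E; last by rewrite -EFinD -splitr.
apply: leeD.
  apply: (@le_trans _ _ (\sum_(n <oo) mu (G n `\` F n))%E).
    apply: measure_sigma_subadditive => //.
    - by move=> n; exact: measurableD.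
    - exact: measurableD.
    - move=> x [[n _ Gx] nF]; exists n => //; split => // Fx; apply: nF.
      by exists n.
  apply: (@le_trans _ _ (\sum_(n <oo) (0 + (e / 2 / (2 ^ n.+1)%:R)%:E))%E).
    apply: lee_nneseries => [n _ _|n _]; first exact: measure_ge0.
    by rewrite add0e; have [] := HFG n.
  apply: le_trans (epsilon_trick _ _ _) _ => //; first exact: ltW.
  by rewrite eseries0 ?add0e.
rewrite measureD//; last by rewrite ltey_eq fin_num_measure.
rewrite (_ : \bigcup_n F n `&` B N = B N); last first.
  by apply/setIidPr; rewrite -UB; exact: bigcup_sup.
have h : mu (\bigcup_n F n) = (prob mu (\bigcup_n F n))%:E := probE mu mUF.
have h' : mu (B N) = (prob mu (B N))%:E := probE mu (mB N).
rewrite [X in (X - _)%E]h [X in (_ - X)%E]h' -EFinB lee_fin.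
by move: hN; rewrite ltr_norml; lra.
Qed.

Lemma borel_regular (A : set X) : measurable (A : set (borel X)) -> regular_set A.
Proof.
apply: smallest_sub; last exact: open_regular.
split.
- by apply: open_regular; exact: open0.
- by move=> B rB; rewrite setTD; exact: setC_regular.
- exact: bigcup_regular.
Qed.

Lemma inner_regular (A : set X) (e : R) : measurable (A : set (borel X)) -> 0 < e ->
  exists F : set X, [/\ closed F, F `<=` A & prob mu (A `\` F) <= e].
Proof.
move=> mA e0; have [F [G [cF oG FA AG GF]]] := borel_regular mA e0.
exists F; split => //; have mF := closed_borel cF.
rewrite -lee_fin -probE; last exact: measurableD.
apply: le_trans GF; apply: le_measure; rewrite ?inE.
- exact: measurableD.
- by apply: measurableD => //; exact: open_borel.
- exact: setSD.
Qed.

End regularity.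

(** * Zero topological entropy implies zero measure entropy *)

(** Cross entropy against weight [a] on [ord0] and [b] on each other label: the first costs at most
    [e / 2], the others [- ln b] times their total mass. Neither [a] nor [b] depends on the measure,
    so [s] is uniform. *)
Lemma rare_labels_entropy {R : realType} d (X : measurableType d) (k : nat) (e : R) :
  0 < e -> exists2 s : R, 0 < s &
  forall (mu : probability X R) (eta : X -> 'I_k.+1), measurable_partition eta ->
    \sum_(i < k) fine (mu (eta @^-1` [set lift ord0 i])) <= s ->
    partition_entropy mu eta <= e.
Proof.
move=> e0; pose a := expR (- (e / 2)); pose b := (1 - a) / k%:R.
have a0 : 0 < a by exact: expR_gt0.
have a1 : a < 1 by rewrite -[ltRHS]expR0 ltr_expR; lra.
have c0 : 0 < `|ln b| + 1 by rewrite ltr_wpDl.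
exists (e / 2 / (`|ln b| + 1)); first by rewrite !divr_gt0.
move=> mu eta meta hs.
pose q (i : 'I_k.+1) := if unlift ord0 i is Some _ then b else a.
have q_lift i : q (lift ord0 i) = b by rewrite /q liftK.
have q0 : q ord0 = a by rewrite /q unlift_none.
have b_gt0 (i : 'I_k) : 0 < b.
  by rewrite divr_gt0 ?subr_gt0// ltr0n; apply: leq_ltn_trans (ltn_ord i).
have q_gt0 i : 0 < q i.
  by rewrite /q; case: unliftP => [j _|//]; exact: b_gt0.
apply: le_trans (@partition_entropy_le_cross _ _ _ mu _ eta q meta _ _ _) _.
- by move=> i; rewrite ltW.
- rewrite big_ord_recl q0 (eq_bigr _ (fun i _ => q_lift i)) sumr_const card_ord.
  rewrite -[X in _ + X]mulr_natl /b.
  have [->|k0] := eqVneq k 0%N; first by rewrite mul0r addr0 ltW.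
  by rewrite mulrC divfK ?pnatr_eq0// addrC subrK.
- by move=> i /eqP; rewrite gt_eqF.
rewrite big_ord_recl q0 /a expRK opprD.
set p0 := fine _.
have p01 : p0 <= 1.
  rewrite -(prob_partitionT mu meta) big_ord_recl lerDl sumr_ge0// => i _.
  exact: fine_measure_ge0.
rewrite [leRHS]splitr lerD//.
  by rewrite mulrN opprK ler_piMl// divr_ge0// ltW.
apply: (@le_trans _ _ ((\sum_(i < k) fine (mu (eta @^-1` [set lift ord0 i]))) *
    (`|ln b| + 1))); last by rewrite -ler_pdivlMr.
rewrite mulr_suml -sumrN ler_sum// => i _; rewrite q_lift -mulrN.
rewrite ler_wpM2l ?fine_measure_ge0//.
by rewrite (le_trans (ler_norm _))// normrN lerDl.
Qed.

Lemma first_hit_partition d (X : measurableType d) (N : nat)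
    (G : nat -> set X) : (forall j, measurable (G j)) ->
  (forall x, exists2 j, (j < N)%N & G j x) ->
  exists beta : X -> 'I_N, (forall x, G (beta x) x) /\ measurable_partition beta.
Proof.
move=> mG GN.
have /choice[beta Hb] : forall x, exists j : 'I_N, G j x /\
    forall i, (i < j)%N -> ~ G i x.
  move=> x; have ex : exists j, (j < N)%N && `[< G j x >].
    by have [j jN Gj] := GN x; exists j; rewrite jN; exact/asboolP.
  case: (ex_minnP ex) => j /andP[jN /asboolP Gj] jmin.
  exists (Ordinal jN); split => // i /= ij Gi.
  have : (j <= i)%N by apply: jmin; rewrite (ltn_trans ij jN); exact/asboolP.
  by rewrite leqNgt ij.
exists beta; split => [x|j]; first by have [] := Hb x.
rewrite (_ : _ @^-1` _ = G j `\` \bigcup_(i in `I_j) G i).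
  by apply: measurableD => //; apply: bigcup_measurable.
apply/seteqP; split => x /=.
  move=> <-; have [h1 h2] := Hb x; split => // -[i /= ij]; exact: h2.
move=> [Gj nG]; have [h1 h2] := Hb x.
apply: ord_inj; apply/eqP; rewrite eqn_leq; apply/andP; split; rewrite leqNgt; apply/negP.
  by move=> /h2.
by move=> h; apply: nG; exists (beta x).
Qed.

Lemma cover_number_attained {R : realType} (X : topologicalType)
    (W V0 : set (set X)) : V0 `<=` W -> finite_set V0 ->
  \bigcup_(A in V0) A = setT ->
  exists (k : nat) (V : set (set X)), [/\ V `<=` W, (V #= `I_k)%card,
    \bigcup_(A in V) A = setT & cover_number W = k%:R :> R].
Proof.
move=> V0W [k0 V0k] V0T.
pose P k := `[< exists V : set (set X),
    [/\ V `<=` W, (V #= `I_k)%card & \bigcup_(A in V) A = setT] >].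
have ex : exists k, P k by exists k0; apply/asboolP; exists V0.
case: (ex_minnP ex) => k /asboolP[V [VW Vk VT]] kmin.
exists k, V; split => //; apply/eqP; rewrite eq_le; apply/andP; split.
  apply: ge_inf; last by exists k => //; exists V.
  by exists 0 => _ [? _ <-].
apply: lb_le_inf; first by exists k%:R, k => //; exists V.
by move=> _ [j Pj <-]; rewrite ler_nat; apply: kmin; exact/asboolP.
Qed.

Section goodwyn.
Context {R : realType} {X : pointedMetricType R}.
Variables (T : X -> X) (mu : probability (borel X) R).
Hypothesis cT : continuous T.
Hypothesis inv : forall A, measurable (A : set (borel X)) -> mu (T @^-1` A) = mu A.

Lemma continuous_borel_preimage (A : set X) : measurable (A : set (borel X)) ->
  measurable (T @^-1` A : set (borel X)).
Proof.
have mT : measurable_fun [set: borel X] (T : borel X -> borel X).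
  apply: (@measurability _ _ (borel X) (borel X) setT T (@open X)) => //.
  move=> _ [B oB <-]; rewrite setTI; apply: open_borel.
  by move/continuousP: cT; apply.
by move=> mA; rewrite -[X in measurable X]setTI; exact: mT.
Qed.

Local Notation TB := (T : borel X -> borel X).

Section one_partition.
Variables (k : nat) (xi : borel X -> 'I_k) (K : 'I_k -> set X).
Hypothesis mxi : measurable_partition xi.
Hypothesis cK : forall i, closed (K i).
Hypothesis Kxi : forall i, K i `<=` xi @^-1` [set i].

(** Removing the closed cores of all the other cells gives an open cover that determines labels on
    the cores: a point of [K j] lies in [U i] only for [i = j]. *)
Let U (i : 'I_k) : set X := ~` \bigcup_(j in [set j | j != i]) K j.
Let cov := [set U i | i in [set: 'I_k]].
(** [ord0] marks the points whose label the cover reveals. The remaining points carry their own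
    label, and they are rare, so [eta] has small entropy. *)
Let eta (x : borel X) : 'I_k.+1 :=
  if `[< K (xi x) x >] then ord0 else lift ord0 (xi x).
Let G n (l : nat -> 'I_k) : set X := \bigcap_(i < n) (iter i T @^-1` U (l i)).

Let oU i : open (U i).
Proof.
apply: closed_openC; apply: closed_bigcup => //.
exact: finite_finset.
Qed.

Let U_label x i : U i x -> K (xi x) x -> xi x = i.
Proof.
move=> Ux Kx; apply/eqP; apply: contrapT => /negP ni.
by apply: Ux; exists (xi x).
Qed.

Let U_xi x : U (xi x) x.
Proof. by move=> [j /= /eqP ji /Kxi /= xj]; apply: ji. Qed.

Let open_cover_cov : open_cover cov.
Proof.
split; first by move=> _ [i _ <-]; exact: oU.
apply/seteqP; split => // x _; exists (U (xi x)); last exact: U_xi.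
by exists (xi x).
Qed.

Let eta_lift i : eta @^-1` [set lift ord0 i] = xi @^-1` [set i] `\` K i.
Proof.
apply/seteqP; split => x; rewrite /eta /=.
  case: asboolP => [_ /eqP|nK /lift_inj <-//].
  by rewrite (negbTE (neq_lift _ _)).
by move=> [<- nK]; rewrite asboolF.
Qed.

Lemma bad_labels_measurable : measurable_partition eta.
Proof.
move=> j; case: (unliftP ord0 j) => [i ->|->].
  by rewrite eta_lift; apply: measurableD => //; exact: closed_borel.
rewrite (_ : _ @^-1` _ = \bigcup_(i in [set: 'I_k]) K i).
  by apply: fin_bigcup_measurable => // i _; exact: closed_borel.
apply/seteqP; split => x; rewrite /eta /=.
  by case: asboolP => [Kx _|_ /eqP]; [exists (xi x)|].
by move=> [i _ Kx]; rewrite asboolT// (Kxi Kx).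
Qed.

Let cT_iter i : continuous (iter i T).
Proof.
elim: i => [|i IH] x; first exact: cvg_id.
by apply: continuous_comp; [exact: IH|exact: cT].
Qed.

Let oG n l : open (G n l).
Proof.
rewrite /G bigcap_mkord; elim/big_ind : _ => //; first exact: openT.
  exact: openI.
by move=> i _; apply: open_comp => // x _; exact: cT_iter.
Qed.

Let cover_joinE n : cover_join T cov n = range (G n).
Proof.
apply/seteqP; split => [_ [a ha <-]|_ [l _ <-]].
  have /choice[l hl] : forall i, exists l : 'I_k, U l = a i.
    by move=> i; have [l _ la] := ha i; exists l.
  by exists l => //; rewrite /G; under eq_bigcapr do rewrite hl.
by exists (U \o l) => // i /=; exists (l i).
Qed.

Let cover_join_finite n : exists V0, [/\ V0 `<=` cover_join T cov n, finite_set V0 &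
  \bigcup_(A in V0) A = setT].
Proof.
(* The join only reads labels below [n]; beyond, [xi point] is a filler. *)
pose l (w : {ffun 'I_n -> 'I_k}) i := if insub i is Some i' then w i' else xi point.
exists [set G n (l w) | w in [set: {ffun 'I_n -> 'I_k}]]; split.
- by move=> _ [w _ <-]; rewrite cover_joinE; exists (l w).
- by apply: finite_image; exact: finite_finset.
- apply/seteqP; split => // x _.
  exists (G n (l [ffun i : 'I_n => xi (iter i T x)])).
    by exists [ffun i : 'I_n => xi (iter i T x)].
  move=> i /= ni; rewrite /l insubT ffunE /=; exact: U_xi.
Qed.

(* The join of xi is determined by the first element of the subcover containing
   x and by the labels eta: where eta = ord0, the point lies in K (xi x), and the
   cover element then determines xi x. *)
Lemma partition_entropy_le_cover n :
  partition_entropy mu (partition_join TB xi n) <=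
  ln (cover_number (cover_join T cov n)) + n%:R * partition_entropy mu eta.
Proof.
have [V0 [V0W fV0 V0T]] := cover_join_finite n.
have [m [V [VW Vm VT ->]]] := @cover_number_attained R X _ _ V0W fV0 V0T.
have [h hV] : exists h : nat -> set X, V = h @` `I_m.
  move: Vm; rewrite card_eq_sym => /card_set_bijP[h [hfun _ hsurj]].
  exists h; apply/seteqP; split; first exact: hsurj.
  by move=> _ [i im <-]; exact: hfun.
have /choice[l hl] : forall j, exists l, (j < m)%N -> h j = G n l.
  move=> j; have [jm|] := ltnP j m; last by move=> _; exists (fun=> xi point).
  have : V (h j) by rewrite hV; exists j.
  by move/VW; rewrite cover_joinE => -[l _ <-]; exists l.
have mG j : measurable (G n (l j) : set (borel X)) by apply: open_borel; exact: oG.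
have hits x : exists2 j, (j < m)%N & G n (l j) x.
  have : (\bigcup_(A in V) A) x by rewrite VT.
  by rewrite hV => -[_ [j jm <-] hx]; exists j; rewrite // -hl.
have [beta [hbeta mbeta]] := first_hit_partition mG hits.
pose Phi (u : 'I_m * {ffun 'I_n -> 'I_k.+1}) : {ffun 'I_n -> 'I_k} :=
  [ffun i : 'I_n => if unlift ord0 (u.2 i) is Some i' then i' else l u.1 i].
have mjoin := @measurable_partition_join _ _ TB _ eta
  continuous_borel_preimage bad_labels_measurable n.
have -> : partition_join TB xi n =
    Phi \o partition_pair beta (partition_join TB eta n).
  apply/funext => x; apply/ffunP => i; rewrite !ffunE /= ?ffunE /eta.
  case: asboolP => [Kx|nKx]; last by rewrite liftK.
  rewrite unlift_none; apply: U_label => //.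
  exact: (hbeta x i (ltn_ord i)).
apply: le_trans (partition_entropy_comp_le _ _ _) _.
  exact: measurable_partition_pair.
apply: le_trans (partition_entropy_pair_le _ mbeta mjoin) _.
apply: lerD.
  rewrite -[X in ln X%:R](card_ord m); apply: partition_entropy_le_card => //.
  rewrite card_ord; exact: leq_ltn_trans (ltn_ord (beta point)).
exact: (@partition_entropy_join_le _ (borel X) R mu TB _ eta
  continuous_borel_preimage inv bad_labels_measurable n).
Qed.

Lemma ks_entropy_partition_le (c : R) : 0 < c ->
  (partition_entropy mu eta <= c / 2) -> top_entropy T = 0%E :> \bar R ->
  (ks_entropy_partition TB mu xi <= c%:E)%E.
Proof.
move=> c0 He top0.
have : (cover_entropy T cov < (c / 2)%:E :> \bar R)%E.
  apply: (@le_lt_trans _ _ 0%E); last by rewrite lte_fin divr_gt0.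
  by rewrite -top0; apply: ereal_sup_ubound; exists cov.
move=> /limn_esup_lt near_n; apply: limn_esup_le.
near=> n.
have n0 : 0 < n%:R :> R by rewrite ltr0n; near: n; exact: nbhs_infty_gt.
have : (ln (cover_number (cover_join T cov n)) / n%:R < c / 2 :> R).
  by rewrite -lte_fin; near: n.
rewrite lee_fin !ltr_pdivrMr// ler_pdivrMr// => h.
apply: le_trans (partition_entropy_le_cover n) _.
have : n%:R * partition_entropy mu eta <= n%:R * (c / 2) by rewrite ler_pM2l.
move: h; lra.
Unshelve. all: by end_near. Qed.

Lemma sum_eta : \sum_(i < k) fine (mu (eta @^-1` [set lift ord0 i])) =
  \sum_(i < k) prob mu (xi @^-1` [set i] `\` K i).
Proof. by apply: eq_bigr => i _; rewrite eta_lift. Qed.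

End one_partition.

Lemma ks_entropy_ge0 : (0 <= ks_entropy (T : borel X -> borel X) mu)%E.
Proof.
apply: ereal_sup_ubound; exists 1%N, (fun=> ord0).
have m1 : measurable_partition (fun _ : borel X => ord0 : 'I_1).
  move=> i; rewrite (_ : _ @^-1` _ = setT)//; apply/seteqP; split => // x _ /=.
  by apply/esym; exact: ord1.
split => //; apply/esym; rewrite /ks_entropy_partition.
rewrite (_ : (fun n => _) = cst 0%E).
  by apply: (cvg_limn_einf_sup _).2; exact: cvg_cst.
apply/funext => n; rewrite /cst.
have mj := @measurable_partition_join _ _ TB _ _ continuous_borel_preimage m1 n.
suff -> : partition_entropy mu (partition_join TB (fun=> ord0 : 'I_1) n) = 0.
  by rewrite mul0r.
apply/eqP; rewrite eq_le partition_entropy_ge0// andbT.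
apply: le_trans (partition_entropy_le_card mu mj _) _.
  by rewrite card_ffun !card_ord exp1n.
by rewrite card_ffun !card_ord exp1n ln1.
Qed.

(** Goodwyn's inequality in the case of zero entropy. Inner regularity provides closed cores that
    miss a mass of at most [s / k] in each cell, so that [eta] has entropy at most [c / 2]; the
    cover accounts for the rest of [c]. *)
Theorem zero_top_entropy_ks_entropy : top_entropy T = 0%E :> \bar R ->
  ks_entropy (T : borel X -> borel X) mu = 0%E.
Proof.
move=> top0; apply/eqP; rewrite eq_le ks_entropy_ge0 andbT.
apply: ge_ereal_sup => _ [k [xi [mxi ->]]].
apply/lee_addgt0Pr => c c0; rewrite add0e.
have c2 : 0 < c / 2 by rewrite divr_gt0.
have [s s0 Hs] := rare_labels_entropy (borel X) k c2.
have k0 : (0 < k)%N by exact: leq_ltn_trans (ltn_ord (xi point)).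
have sk : 0 < s / k%:R by rewrite divr_gt0// ltr0n.
have /choice[K HK] : forall i, exists F : set X,
    [/\ closed F, F `<=` xi @^-1` [set i] & prob mu (xi @^-1` [set i] `\` F) <= s / k%:R].
  by move=> i; apply: inner_regular => //; exact: mxi.
have cK i : closed (K i) by have [] := HK i.
have Kxi i : K i `<=` xi @^-1` [set i] by have [] := HK i.
apply: (@ks_entropy_partition_le k xi K mxi cK Kxi c) => //.
apply: Hs; first exact: bad_labels_measurable.
rewrite sum_eta//; apply: (@le_trans _ _ (\sum_(i < k) s / k%:R)).
  by apply: ler_sum => i _; have [] := HK i.
by rewrite sumr_const card_ord -[X in X <= _]mulr_natl mulrC divfK// pnatr_eq0 -lt0n.
Qed.

End goodwyn.

(** * Approximation of sequences with few words *)

Lemma ultrafilter_pigeonhole (T : Type) (U : set_system T) (t : nat)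
    (P : 'I_t -> set T) : UltraFilter U ->
  U [set x | exists i, P i x] -> exists i, U (P i).
Proof.
move=> UU UP; have PU := @ultra_proper _ _ UU.
apply: contrapT => /forallNP nP.
have H : U [set x | forall i, ~ P i x].
  apply: filter_forall => i.
  by have [] := in_ultra_setVsetC (P i) UU => // /nP.
have [x [[i Pix] nPx]] := filter_ex (filterI UP H).
exact: nPx Pix.
Qed.

Section windows.
Variable A : eqType.
Implicit Types (q y : nat -> A) (D : seq (seq A)).

Definition win q n K : seq A := mkseq (fun i => q (n + i)%N) K.

Lemma size_win q n K : size (win q n K) = K.
Proof. exact: size_mkseq. Qed.

Lemma eq_win q1 q2 n1 n2 K :
  (forall i, (i < K)%N -> q1 (n1 + i)%N = q2 (n2 + i)%N) <-> win q1 n1 K = win q2 n2 K.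
Proof.
split=> [H|H i iK].
  by apply/eq_in_map => i; rewrite mem_iota => /andP[_]; exact: H.
have x0 := q1 0%N.
have := congr1 (fun s => nth x0 s i) H.
by rewrite !nth_mkseq.
Qed.

Lemma win_cat q n K L : win q n (K + L) = win q n K ++ win q (n + K) L.
Proof.
rewrite /win /mkseq iotaD map_cat; congr (_ ++ _); rewrite add0n.
rewrite -{1}[K]addn0 iotaDl -map_comp; apply: eq_map => i /=.
by rewrite addnA.
Qed.

Lemma win_sub q n K r L : (r + L <= K)%N ->
  win q (n + r) L = take L (drop r (win q n K)).
Proof.
move=> /subnKC <-; rewrite -addnA !win_cat drop_size_cat ?size_win//.
by rewrite take_size_cat ?size_win.
Qed.

Lemma win_flatten q n K t :
  win q n (t * K) = flatten (mkseq (fun i => win q (n + i * K) K) t).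
Proof.
elim: t => [|t IH]; first by rewrite mul0n.
rewrite mulSnr win_cat IH /mkseq -addn1 iotaD map_cat flatten_cat /= cats0.
by rewrite add0n.
Qed.

Fixpoint tuples_of D t : seq (seq (seq A)) :=
  if t is t'.+1 then [seq d :: w | d <- D, w <- tuples_of D t'] else [:: [::]].

Lemma size_tuples_of D t : size (tuples_of D t) = (size D ^ t)%N.
Proof. by elim: t => [//|t IH] /=; rewrite size_allpairs IH expnS. Qed.

Lemma mem_tuples_of D w : all (mem D) w -> w \in tuples_of D (size w).
Proof.
elim: w => [//|d w IH] /= /andP[dD /IH wD].
by apply/allpairsP; exists (d, w).
Qed.

Lemma win_cover q n0 K D : (0 < K)%N ->
  (forall a, (n0 <= a)%N -> a = n0 %[mod K] -> win q a K \in D) ->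
  forall L, exists Ws, (forall p, win q p L \in Ws) /\
    size Ws = (n0 + K * size D ^ (L %/ K + 2))%N.
Proof.
move=> K0 HD L; set t := (L %/ K + 2)%N.
exists ([seq win q p L | p <- iota 0 n0] ++
  [seq take L (drop r (flatten w)) | r <- iota 0 K, w <- tuples_of D t]); split.
  move=> p; rewrite mem_cat; have [pn|np] := ltnP p n0.
    by apply/orP; left; apply/mapP; exists p => //; rewrite mem_iota.
  apply/orP; right; apply/allpairsP.
  pose r := ((p - n0) %% K)%N; pose a := (n0 + (p - n0) %/ K * K)%N.
  have pE : p = (a + r)%N by rewrite /a /r -addnA -divn_eq subnKC.
  pose w := mkseq (fun i => win q (a + i * K) K) t.
  exists (r, w); split => /=.
  - by rewrite mem_iota add0n ltn_mod.
  - rewrite -[t](size_mkseq (fun i => win q (a + i * K) K)).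
    apply: mem_tuples_of; apply/allP => _ /mapP[i _ ->]; apply: HD.
      by rewrite /a -addnA leq_addr.
    by rewrite /a -addnA -mulnDl addnC modnMDl.
  rewrite -win_flatten {1}pE; apply: win_sub.
  have rK : (r < K)%N by rewrite ltn_mod.
  rewrite /t mulnDl; have := divn_eq L K; have : (L %% K < K)%N by rewrite ltn_mod.
  lia.
by rewrite size_cat size_map size_iota size_allpairs size_iota size_tuples_of.
Qed.

End windows.

(** A bad starting point is charged for the [K] positions of its block. The condition [s <= n] keeps
    truncated subtraction from assigning earlier positions to the first block. *)
Lemma count_aligned_le (bad : pred nat) (K s N : nat) : (s < K)%N ->
  (count (fun n => (s <= n) && bad (s + (n - s) %/ K * K)) (iota 0 N) <=
   K * count (fun n => (n %% K == s) && bad n) (iota 0 N))%N.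
Proof.
move=> sK; have K0 : (0 < K)%N by exact: leq_ltn_trans sK.
rewrite -!size_filter.
rewrite mulnC -[X in (_ <= _ * X)%N](size_iota 0 K) -(size_allpairs addn).
apply: uniq_leq_size; first by rewrite filter_uniq// iota_uniq.
move=> n; rewrite mem_filter mem_iota /= add0n => /andP[/andP[sn bn] nN].
apply/allpairsP; exists ((s + (n - s) %/ K * K)%N, ((n - s) %% K)%N) => /=; split.
- rewrite mem_filter mem_iota /= add0n bn andbT addnC modnMDl modn_small// eqxx/=.
  by apply: leq_ltn_trans nN; have := leq_trunc_div (n - s) K; lia.
- by rewrite mem_iota add0n ltn_mod.
- by rewrite -addnA -divn_eq subnKC.
Qed.

(** The residues [s + K * i] are distinct, so each bad position is counted at most once. *)
Lemma count_residues_le (bad : pred nat) (K s t : nat) (l : seq nat) : (0 < K)%N ->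
  (\sum_(i < t) count (fun n => (n %% (K * t) == s + K * i) && bad n) l <=
   count bad l)%N.
Proof.
move=> K0; elim: l => [|n l IH] /=; first by rewrite big1.
rewrite big_split /= leq_add//.
case: (bad n); last by rewrite big1// => i _; rewrite andbF.
under eq_bigr do rewrite andbT.
have [/existsP[i /eqP ni]|/existsPn no] :=
  boolP [exists i : 'I_t, (n %% (K * t) == s + K * i)%N].
  rewrite (bigD1 i)//= ni eqxx big1 => [//|k ki].
  rewrite eqn_add2l eqn_pmul2l// eq_sym.
  by apply/eqP; rewrite eqb0; apply: contra ki => /eqP/ord_inj ->.
by rewrite big1// => i _; rewrite (negbTE (no i)).
Qed.

Section zero_entropy_approximation.
Context {R : realType} {A : finType}.
Variables (a0 : A) (q : nat -> A) (U : set_system nat) (S : set nat) (eta : R).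
Hypothesis UU : UltraFilter U.
Hypothesis Uoo : forall m, U [set N | (m <= N)%N].
Hypothesis US : U S.
Hypothesis eta0 : 0 < eta.
Hypothesis few_words : forall d : R, 0 < d -> exists K0, forall K, (K0 <= K)%N ->
  exists C : seq (seq A), (size C)%:R <= expR (d * K%:R) :> R /\
    U [set N | (count (fun n => win q n K \notin C) (iota 0 N))%:R <= d * N%:R].

Let PU : ProperFilter U := @ultra_proper _ _ UU.

(* The factor 1 / K compensates for the fact that each bad starting point blanks
   a whole block of length K. *)
Definition good_stage (j K s : nat) (C : seq (seq A)) :=
  [/\ (j < K)%N, (s < K)%N, (size C)%:R <= expR (j.+1%:R^-1 * K%:R) :> R &
    U [set N | (count (fun n => (n %% K == s)%N && (win q n K \notin C))
      (iota 0 N))%:R <= eta / (2 ^ j.+1)%:R / K%:R * N%:R]].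

(* Among the t lifts of the phase s modulo K to phases modulo K t, one sees at
   most the average number of bad windows. *)
Lemma next_stage j K s : (s < K)%N -> exists K' s' C,
  [/\ good_stage j K' s' C, (K %| K')%N & (s' %% K = s)%N].
Proof.
move=> sK; have K0 : (0 < K)%N by exact: leq_ltn_trans sK.
(* The first bound controls the number of words. The second becomes the required density: choosing
   one of [t] phases divides it by [t], and [K' = K * t]. *)
pose d := Num.min j.+1%:R^-1 (eta / (2 ^ j.+1)%:R / K%:R) : R.
have d0 : 0 < d.
  by rewrite lt_min invr_gt0 ltr0n/= !divr_gt0// ltr0n// expn_gt0.
have [K1 HK1] := few_words d0.
pose t := (K1 + j).+1; pose K' := (K * t)%N.
have tK' : (t <= K')%N by rewrite /K' leq_pmull.
have [|C [sC UC]] := HK1 K'; first by apply: leq_trans tK'; rewrite /t; lia.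
have [i Ui] : exists i : 'I_t, U [set N |
    (count (fun n => (n %% K' == s + K * i)%N && (win q n K' \notin C)) (iota 0 N))%:R
      <= d / t%:R * N%:R].
  apply: ultrafilter_pigeonhole; apply: filterS UC => N /= HN.
  apply: contrapT => /forallNP nH.
  have := @count_residues_le (fun n => win q n K' \notin C) K s t (iota 0 N) K0.
  rewrite -(ler_nat R) natr_sum => /le_trans/(_ HN).
  apply/negP; rewrite -ltNge.
  have -> : d * N%:R = \sum_(i < t) d / t%:R * N%:R.
    rewrite sumr_const card_ord -[RHS]mulr_natl; field.
    by rewrite pnatr_eq0.
  apply: ltr_sum => [|i _]; first by apply/hasP; exists ord0; rewrite ?mem_index_enum.
  by rewrite ltNge; apply/negP; exact: nH.
exists K', (s + K * i)%N, C; split; first split.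
- by apply: leq_trans tK'; rewrite /t; lia.
- have : (i.+1 * K <= t * K)%N by rewrite leq_mul2r ltn_ord orbT.
  rewrite /K'; nia.
- apply: (le_trans sC); rewrite ler_expR ler_wpM2r//.
  by rewrite ge_min lexx.
- apply: filterS Ui => N /= /le_trans; apply; rewrite ler_wpM2r//.
  rewrite /K' natrM invfM mulrA ler_wpM2r ?invr_ge0//.
  by rewrite ge_min lexx orbT.
- exact: dvdn_mulr.
- by rewrite addnC mulnC modnMDl modn_small.
Qed.

Let stage := (nat * nat * seq (seq A))%type.

Let stages : exists st : nat -> stage,
  (forall j, good_stage j (st j).1.1 (st j).1.2 (st j).2) /\
  (forall j, (st j).1.1 %| (st j.+1).1.1 /\ (st j.+1).1.2 %% (st j).1.1 = (st j).1.2)%N.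
Proof.
have /choice[F HF] : forall x : nat * (nat * nat), exists st' : stage,
    (x.2.2 < x.2.1)%N -> [/\ good_stage x.1 st'.1.1 st'.1.2 st'.2,
      (x.2.1 %| st'.1.1)%N & (st'.1.2 %% x.2.1 = x.2.2)%N].
  move=> [j [K s]] /=; have [sK|] := boolP (s < K)%N; last by exists (0, 0, [::])%N.
  have [K' [s' [C H]]] := next_stage j sK.
  by exists (K', s', C).
(* The recursion starts from modulus 1 and phase 0, which every stage refines. *)
pose fix st j : stage := if j is j'.+1 then F (j, (st j').1) else F (0, (1, 0))%N.
have good j : good_stage j (st j).1.1 (st j).1.2 (st j).2.
  elim: j => [|j [_ sK _ _]]; first by have [] := HF (0, (1, 0))%N isT.
  by have [] := HF (j.+1, (st j).1) sK.
exists st; split => // j; have [_ sK _ _] := good j.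
by have [] := HF (j.+1, (st j).1) sK.
Qed.

Section with_stages.
Variable st : nat -> stage.
Let K j := (st j).1.1.
Let s j := (st j).1.2.
Let C j := (st j).2.
Hypothesis good : forall j, good_stage j (K j) (s j) (C j).
Hypothesis nested : forall j, (K j %| K j.+1)%N /\ (s j.+1 %% K j = s j)%N.

Let sK j : (s j < K j)%N. Proof. by have [] := good j. Qed.
Let jK j : (j < K j)%N. Proof. by have [] := good j. Qed.
Let K_gt0 j : (0 < K j)%N. Proof. exact: leq_ltn_trans (jK j). Qed.

Let K_dvd i j : (i <= j)%N -> (K i %| K j)%N.
Proof.
elim: j => [|j IH]; first by rewrite leqn0 => /eqP ->.
rewrite leq_eqVlt ltnS => /orP[/eqP ->//|/IH ij].
by apply: dvdn_trans ij _; have [] := nested j.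
Qed.

Let s_mod i j : (i <= j)%N -> (s j %% K i = s i)%N.
Proof.
elim: j => [|j IH]; first by rewrite leqn0 => /eqP ->; rewrite modn_small.
rewrite leq_eqVlt ltnS => /orP[/eqP ->|ij]; first by rewrite modn_small.
by rewrite -(IH ij) -[in RHS](nested j).2 modn_dvdm// K_dvd.
Qed.

Let start j n := (s j + (n - s j) %/ K j * K j)%N.
Let E j n := win q (start j n) (K j) \notin C j.

Let E_count j : U [set N |
  (count (fun n => (s j <= n)%N && E j n) (iota 0 N))%:R <=
  eta / (2 ^ j.+1)%:R * N%:R].
Proof.
have [_ _ _] := good j; apply: filterS => N /= HN.
have := @count_aligned_le (fun n => win q n (K j) \notin C j) (K j) (s j) N (sK j).
rewrite -(ler_nat R) => /le_trans; apply.
have K0 : 0 < (K j)%:R :> R by rewrite ltr0n.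
rewrite natrM mulrC -ler_pdivlMr//.
by move: HN; rewrite mulrAC.
Qed.

(** Only finite intersections stay in [U], hence the restriction to the scales [i <= j]. *)
Let pick_ex j m : exists N, [/\ (m <= N)%N, S N & forall i, (i <= j)%N ->
  (count (fun n => (s i <= n)%N && E i n) (iota 0 N))%:R <=
  eta / (2 ^ i.+1)%:R * N%:R].
Proof.
have H : U [set N | forall i : 'I_j.+1,
    (count (fun n => (s i <= n)%N && E i n) (iota 0 N))%:R <=
    eta / (2 ^ i.+1)%:R * N%:R].
  by apply: filter_forall => i; exact: E_count.
have [N [[/= mN SN] HN]] := filter_ex (filterI (filterI (Uoo m) US) H).
exists N; split => // i ij; exact: (HN (Ordinal (ij : (i < j.+1)%N))).
Qed.

Let pick j m := sval (cid (pick_ex j m)).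

(** [W j.+1] has the phase of scale [j.+1] and lies beyond the time picked for scale [j], which
    itself depends on [W j]; before that time, scale [j.+1] blanks nothing. *)
Let W := fix W j := if j is j'.+1 then (s j + K j * (pick j' (W j' + j')).+1)%N else s 0.
Let Nj j := pick j (W j + j)%N.

Let NjP j : [/\ (W j + j <= Nj j)%N, S (Nj j) & forall i, (i <= j)%N ->
  (count (fun n => (s i <= n)%N && E i n) (iota 0 (Nj j)))%:R <=
  eta / (2 ^ i.+1)%:R * (Nj j)%:R].
Proof. exact: svalP (cid (pick_ex j (W j + j))). Qed.

Let WS j : W j.+1 = (s j.+1 + K j.+1 * (Nj j).+1)%N. Proof. by []. Qed.

Let W_mod j : (W j %% K j = s j)%N.
Proof.
case: j => [|j]; first by rewrite /W modn_small.
by rewrite WS addnC mulnC modnMDl modn_small.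
Qed.

Let W_ge j : (s j <= W j)%N.
Proof. by case: j => [//|j]; rewrite WS leq_addr. Qed.

Let Nj_lt j : (Nj j < W j.+1)%N.
Proof. by rewrite WS; have := K_gt0 j.+1; nia. Qed.

Let W_le i j : (i <= j)%N -> (W i <= W j)%N.
Proof.
elim: j => [|j IH]; first by rewrite leqn0 => /eqP ->.
rewrite leq_eqVlt ltnS => /orP[/eqP ->//|/IH ij].
apply: (leq_trans ij); have [+ _ _] := NjP j; have := Nj_lt j; lia.
Qed.

(* start j n is the left end of the K j-block of phase s j containing n. *)
Definition approx n := if `[< exists j, (W j <= n)%N && E j n >] then a0 else q n.

(** Before [Nj j] only the scales up to [j] are active, and their densities [eta / 2 ^ i.+1] sum to
    less than [eta]. *)
Let approx_count j :
  (count (fun n => approx n != q n) (iota 0 (Nj j)))%:R <= eta * (Nj j)%:R.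
Proof.
have [_ _ HN] := NjP j.
apply: (@le_trans _ _ (\sum_(i < j.+1) (count (fun n => (s i <= n)%N && E i n)
    (iota 0 (Nj j)))%:R)).
  rewrite -natr_sum ler_nat.
  have : all (fun n => n < Nj j)%N (iota 0 (Nj j)).
    by apply/allP => n; rewrite mem_iota.
  elim: (iota 0 (Nj j)) => [|n l IH] /=; first by rewrite big1.
  move=> /andP[nN /IH {}IH]; rewrite big_split/= leq_add//.
  rewrite /approx; case: asboolP => [[i /andP[Wi Ei]]|_]; last by rewrite eqxx.
  have ij : (i < j.+1)%N.
    rewrite ltnNge; apply/negP => ji.
    have := W_le ji; have := Nj_lt j; lia.
  rewrite (bigD1 (Ordinal ij))//= Ei (leq_trans (W_ge i) Wi)/=.
  by case: (_ != _).
apply: (@le_trans _ _ (\sum_(i < j.+1) eta / (2 ^ i.+1)%:R * (Nj j)%:R)).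
  by apply: ler_sum => i _; apply: HN; rewrite -ltnS.
rewrite -mulr_suml ler_wpM2r// -mulr_sumr ler_piMr ?(ltW eta0)//.
have -> : \sum_(i < j.+1) (2 ^ i.+1)%:R^-1 = 1 - (2 ^ j.+1)%:R^-1 :> R.
  elim: j.+1 => [|k IH]; first by rewrite big_ord0 expn0 invr1 subrr.
  rewrite big_ord_recr/= IH (expnS 2 k) natrM; field.
  by rewrite pnatr_eq0 -lt0n expn_gt0.
by rewrite gerBl invr_ge0.
Qed.

(** By nesting, the blocks of a smaller scale [i] subdivide an aligned block of scale [j]. *)
Let aligned_sub i j a r : (i <= j)%N -> (s j <= a)%N -> (a %% K j = s j)%N ->
  start i (a + r) = (a + r %/ K i * K i)%N.
Proof.
move=> ij sa aj; have ai : (a %% K i = s i)%N.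
  by rewrite -(s_mod ij) -aj modn_dvdm// K_dvd.
have aE : a = (a %/ K i * K i + s i)%N by rewrite [LHS](divn_eq a (K i)) ai.
rewrite /start; have -> : (a + r - s i = a %/ K i * K i + r)%N.
  by rewrite [X in (X + r - _)%N]aE addnAC addnK.
by rewrite divnMDl ?K_gt0// mulnDl addnA [(s i + _)%N]addnC -aE.
Qed.

(** Conversely, an aligned block of scale [j] lies inside a single block of a larger scale [i]. *)
Let aligned_sup i j a r : (j <= i)%N -> (s i <= a)%N -> (a %% K j = s j)%N ->
  (r < K j)%N -> start i (a + r) = start i a.
Proof.
move=> ji sa aj rK; rewrite /start; congr (_ + _ * _)%N.
have /dvdnP[t Kt] := K_dvd ji.
have /dvdnP[c Hc] : (K j %| a - s i)%N.
  by rewrite -eqn_mod_dvd// aj -(s_mod ji) eqxx.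
rewrite -addnBAC// Hc Kt mulnC (mulnC t) !divnMA.
by rewrite mulnC divnMDl ?K_gt0// mulnK ?K_gt0// (divn_small rK) addn0.
Qed.

(** Modulo [K j], the threshold [W i] has the phase of the block, so it never cuts the block. *)
Let W_aligned i j a r : (j <= i)%N -> (a %% K j = s j)%N -> (r < K j)%N ->
  (W i <= a + r)%N = (W i <= a)%N.
Proof.
move=> ji aj rK; apply/idP/idP => [|Wa]; last by rewrite (leq_trans Wa)// leq_addr.
have Wj : (W i %% K j = s j)%N.
  by rewrite -(s_mod ji) -(W_mod i) modn_dvdm// K_dvd.
rewrite (divn_eq (W i) (K j)) (divn_eq a (K j)) Wj aj => H.
have : (W i %/ K j < (a %/ K j).+1)%N.
  by rewrite -(ltn_pmul2r (K_gt0 j)); nia.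
rewrite ltnS => H2; rewrite leq_add2r leq_mul2r H2; exact: orbT.
Qed.

Let blank j a := exists i, [/\ (j <= i)%N, (W i <= a)%N & E i a].

Let approx_blank j a r : (a %% K j = s j)%N -> (r < K j)%N -> blank j a ->
  approx (a + r) = a0.
Proof.
move=> aj rK [i [ji Wi Ei]]; rewrite /approx asboolT//; exists i.
rewrite (W_aligned ji)// Wi /E (aligned_sup ji)//.
exact: leq_trans (W_ge i) Wi.
Qed.

Let approx_nonblank j a r : (W j <= a)%N -> (a %% K j = s j)%N -> (r < K j)%N ->
  ~ blank j a ->
  approx (a + r) = if [exists i : 'I_j, E i (a + r)] then a0 else q (a + r)%N.
Proof.
move=> Wa aj rK nb; rewrite /approx; congr (if _ then _ else _).
apply/asboolP/existsP => [[i /andP[Wi Ei]]|[i Ei]].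
  have [ij|ji] := ltnP i j; first by exists (Ordinal ij).
  exfalso; apply: nb; exists i; split => //; first by rewrite -(W_aligned ji aj rK).
  move: Ei; rewrite /E (aligned_sup ji)//; move: Wi; rewrite (W_aligned ji aj rK).
  exact/leq_trans/W_ge.
exists (i : nat); rewrite Ei andbT (leq_trans _ (leq_addr _ _))//.
by apply: leq_trans (W_le (ltnW (ltn_ord i))) _.
Qed.

(* Larger scales blank whole K j-blocks, and smaller ones only look inside them. *)
Let approx_determined j a b : (W j <= a)%N -> (a %% K j = s j)%N -> ~ blank j a ->
  (W j <= b)%N -> (b %% K j = s j)%N -> ~ blank j b ->
  win q a (K j) = win q b (K j) -> win approx a (K j) = win approx b (K j).
Proof.
move=> Wa aj na Wb bj nb qab; apply/eq_win => r rK.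
rewrite !(@approx_nonblank j)//; congr (if _ then _ else _); last first.
  by move/eq_win: qab; apply.
apply/existsP/existsP => -[i]; rewrite /E.
all: rewrite !(@aligned_sub i j) ?(ltnW (ltn_ord i)) ?(leq_trans (W_ge j))// => Ei.
all: exists i; rewrite !(@aligned_sub i j) ?(ltnW (ltn_ord i)) ?(leq_trans (W_ge j))//.
all: have sub : (r %/ K i * K i + K i <= K j)%N.
1, 3: have /dvdnP[t Kt] := K_dvd (ltnW (ltn_ord i));
  rewrite addnC -mulSn Kt leq_mul2r ltn_divLR ?K_gt0// -Kt rK; exact: orbT.
all: by move: Ei; rewrite !(@win_sub _ _ _ (K j)) ?qab.
Qed.

(** Beyond [W j], an aligned window of [approx] is constantly [a0] or a function [cl] of the window
    of [q]. In the second case that window is in [C j], since otherwise scale [j] itself would have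
    blanked it. *)
Let approx_words j : exists D : seq (seq A), size D = (size (C j)).+1 /\
  forall a, (W j <= a)%N -> (a = W j %[mod K j]) -> win approx a (K j) \in D.
Proof.
have /choice[cl Hcl] : forall w : seq A, exists v : seq A, forall b,
    [/\ (W j <= b)%N, (b %% K j = s j)%N, ~ blank j b & win q b (K j) = w] ->
    win approx b (K j) = v.
  move=> w; have [[b [Wb bj nb bw]]|nob] := pselect (exists b,
    [/\ (W j <= b)%N, (b %% K j = s j)%N, ~ blank j b & win q b (K j) = w]).
    exists (win approx b (K j)) => c [Wc cj nc cw].
    by apply: approx_determined => //; rewrite cw bw.
  by exists [::] => b Hb; exfalso; apply: nob; exists b.
exists (nseq (K j) a0 :: map cl (C j)); rewrite /= size_map; split => // a Wa.
rewrite W_mod => aj; rewrite inE; have [bl|nb] := pselect (blank j a).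
  apply/orP; left; apply/eqP; apply: (@eq_from_nth _ a0).
    by rewrite size_win size_nseq.
  move=> r; rewrite size_win => rK; rewrite nth_mkseq// nth_nseq rK.
  exact: (approx_blank aj).
apply/orP; right; apply/mapP; exists (win q a (K j)); last exact: Hcl.
have : ~~ E j a by apply/negP => Ea; apply: nb; exists j.
rewrite /E negbK -[a in start j a]addn0 (@aligned_sub j j)//.
  by rewrite div0n addn0.
exact: leq_trans (W_ge j) Wa.
Qed.

Lemma approx_complexity (e : R) : 0 < e -> exists L0, forall L, (L0 <= L)%N ->
  exists Ws : seq (seq A), (forall p, win approx p L \in Ws) /\
    (size Ws)%:R <= expR (e * L%:R) :> R.
Proof.
(* An aligned block admits at most exp(x + 1) words. Per letter the exponent is 1/(j+1) + 1/K_j, at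
   most 2/(j+1) because [j < K j], hence at most [e / 2]. *)
move=> e0; pose j := Num.truncn (4 / e).
have je : 2 / j.+1%:R <= e / 2.
  have : 4 / e < j.+1%:R by exact: truncnS_gt.
  rewrite ltr_pdivrMr// ler_pdivrMr ?ltr0n//; lra.
have [D [sD HD]] := approx_words j.
pose x : R := j.+1%:R^-1 * (K j)%:R.
have x0 : 0 <= x by rewrite mulr_ge0.
have sDx : (size D)%:R <= expR (x + 1).
  rewrite sD expRD -natr1.
  have [_ _ hC _] := good j; have h1 := expR_ge1Dx x; have h2 := @expR_ge1Dx R 1.
  have h3 : expR x * 2 <= expR x * expR 1 by rewrite ler_pM2l ?expR_gt0//; lra.
  by rewrite -/x in hC; lra.
(* [B] gathers what does not grow with [L]: the factor [W j + K j], bounded by its exponential, and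
   the two extra blocks of [win_cover]. For large [L] it is absorbed by the other half of [e]. *)
pose B : R := (W j + K j)%:R + 2 * (x + 1).
exists (Num.truncn (B / (e / 2))).+1 => L HL.
have BL : B <= L%:R * (e / 2).
  rewrite -ler_pdivrMr ?divr_gt0//.
  by apply: le_trans (ltW (truncnS_gt _)) _; rewrite ler_nat.
have [Ws [HWs sWs]] := win_cover (K_gt0 j) HD L.
exists Ws; split => //; rewrite {}sWs.
have Kj0 : 0 < (K j)%:R :> R by rewrite ltr0n.
set t := (L %/ K j + 2)%N.
have tx : (x + 1) * t%:R <= 2 * (x + 1) + L%:R * (e / 2).
  have tL : t%:R <= L%:R / (K j)%:R + 2 :> R.
    rewrite /t natrD lerD2r ler_pdivlMr// -natrM ler_nat; exact: leq_trunc_div.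
  have x1 : 0 <= x + 1 by lra.
  apply: le_trans (ler_wpM2l x1 tL) _.
  have -> : (x + 1) * (L%:R / (K j)%:R + 2) =
      2 * (x + 1) + L%:R * (j.+1%:R^-1 + (K j)%:R^-1).
    by rewrite /x; field; rewrite gt_eqF// nat1r pnatr_eq0.
  rewrite lerD2l ler_wpM2l//.
  have : (K j)%:R^-1 <= j.+1%:R^-1 :> R by rewrite lef_pV2 ?posrE// ler_nat.
  move: je; move: (j.+1%:R^-1 : R) ((K j)%:R^-1 : R) => u w; lra.
have Dt : (size D ^ t)%:R <= expR (2 * (x + 1) + L%:R * (e / 2)).
  rewrite natrX (le_trans (lerXn2r t _ _ sDx)) ?nnegrE ?expR_ge0//.
  by rewrite -expRM_natl ler_expR mulrC.
have Y1 : 1 <= expR (2 * (x + 1) + L%:R * (e / 2)).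
  rewrite -[leLHS]expR0 ler_expR addr_ge0//; first lra.
  by rewrite mulr_ge0// divr_ge0// ltW.
apply: (@le_trans _ _ ((W j + K j)%:R * expR (2 * (x + 1) + L%:R * (e / 2)))).
  rewrite !natrD natrM mulrDl lerD//; last by rewrite ler_pM2l.
  by rewrite ler_peMr.
apply: (@le_trans _ _ (expR (B + L%:R * (e / 2)))).
  have -> : B + L%:R * (e / 2) =
      (W j + K j)%:R + (2 * (x + 1) + L%:R * (e / 2)) by rewrite addrA.
  rewrite [leRHS]expRD ler_pM2r ?expR_gt0//.
  by have := @expR_ge1Dx R (W j + K j)%:R; lra.
rewrite ler_expR; move: BL; lra.
Qed.

Lemma approx_often m : exists N, [/\ (m <= N)%N, S N &
  (count (fun n => approx n != q n) (iota 0 N))%:R <= eta * N%:R].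
Proof.
exists (Nj m); have [h1 h2 _] := NjP m; split => //; by apply: leq_trans h1; rewrite leq_addl.
Qed.

End with_stages.

Theorem zero_entropy_approximation : exists y : nat -> A,
  (forall e : R, 0 < e -> exists L0, forall L, (L0 <= L)%N ->
    exists Ws : seq (seq A), (forall p, win y p L \in Ws) /\
      (size Ws)%:R <= expR (e * L%:R) :> R) /\
  (forall m, exists N, [/\ (m <= N)%N, S N &
    (count (fun n => y n != q n) (iota 0 N))%:R <= eta * N%:R]).
Proof.
have [st [good nested]] := stages.
exists (approx good); split; first exact: (approx_complexity good nested).
exact: (approx_often good).
Qed.

End zero_entropy_approximation.

(** * Orbit closures *)

Lemma limn_esup_ge {R : realType} (u : (\bar R)^nat) (c : \bar R) :
  (forall n, (c <= u n)%E) -> (c <= limn_esup u)%E.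
Proof.
move=> H; apply: le_ereal_inf_tmp => _ [A FA <-].
have [n An] := filter_ex (FA : \oo A).
by apply: le_trans (H n) _; apply: ereal_sup_ubound; exists n.
Qed.

Lemma card_set_seq (T : pointedType) (s : seq T) : exists k, (k <= size s)%N /\
  ([set` s] #= `I_k)%card.
Proof.
exists (size (undup s)); split; first exact: size_undup.
case: s => [|x0 s].
  rewrite /= (_ : [set` [::]] = set0) ?II0//.
  by apply/seteqP; split => x.
rewrite card_eq_sym; apply/card_set_bijP.
move: (undup _) (undup_uniq (x0 :: s)) (mem_undup (x0 :: s)) => d ud md.
exists (nth x0 d); split.
- by move=> i /= ilt; rewrite /mkset -md mem_nth.
- move=> i j; rewrite !inE /= => il jl /eqP.
  by rewrite nth_uniq// => /eqP.
- move=> x /= xs; exists (index x d); first by rewrite /mkset index_mem md.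
  by rewrite nth_index// md.
Qed.

Section subshift.
Context {R : realType} {A : finType}.
Variables (a0 : A) (y : nat -> A).

Definition bi_infinite (i : int) : A := if i is Posz n then y n else a0.

Definition agree (n : nat) (u v : int -> A) := forall i : int, (`|i| < n)%N -> u i = v i.

Lemma agree_le m n u v : (m <= n)%N -> agree n u v -> agree m u v.
Proof. by move=> mn H i im; apply: H; exact: leq_trans mn. Qed.

Lemma agree_sym n u v : agree n u v -> agree n v u.
Proof. by move=> H i /H. Qed.

Lemma agree_trans n u v w : agree n u v -> agree n v w -> agree n u w.
Proof. by move=> H1 H2 i im; rewrite H1// H2. Qed.

(** The orbit closure of [bi_infinite] under the two-sided shift, described by central windows: each
    of them occurs in [bi_infinite]. Two-sided sequences make the shift invertible. *)
Definition subshift := {u : int -> A |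
  forall m, exists k : int, agree m u (fun i => bi_infinite (k + i))}.

HB.instance Definition _ := gen_eqMixin subshift.
HB.instance Definition _ := gen_choiceMixin subshift.

Implicit Types u v : subshift.

Local Notation differ u v := (exists n, `[< ~ agree n (sval u) (sval v) >]).

(** Since [agree 0] always holds, the least radius of disagreement is positive and its inverse is a
    genuine one. *)
Definition subshift_dist u v : R :=
  if pselect (differ u v) is left ex then (ex_minn ex)%:R^-1 else 0.

Let subval_inj u v : (forall n, agree n (sval u) (sval v)) -> u = v.
Proof.
case: u v => [u Pu] [v Pv] /= H; apply: boolp.eq_exist.
by apply/funext => i; apply: (H `|i|.+1%N).
Qed.

Let dist_ge n u v : ~ agree n (sval u) (sval v) -> n%:R^-1 <= subshift_dist u v.
Proof.
move=> nuv; rewrite /subshift_dist; case: pselect => [ex|nex]; last first.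
  by exfalso; apply: nex; exists n; exact/asboolP.
case: (ex_minnP ex) => m /asboolP mP mmin.
have m0 : (0 < m)%N by rewrite lt0n; apply/eqP => m0; apply: mP; rewrite m0.
have mn : (m <= n)%N by apply: mmin; exact/asboolP.
by rewrite lef_pV2 ?posrE ?ltr0n ?ler_nat// (leq_trans m0 mn).
Qed.

Let dist_lt n u v : (0 < n)%N -> agree n (sval u) (sval v) ->
  subshift_dist u v < n%:R^-1.
Proof.
move=> n0 uv; rewrite /subshift_dist; case: pselect => [ex|_]; last first.
  by rewrite invr_gt0 ltr0n.
case: (ex_minnP ex) => m /asboolP mP _.
have nm : (n < m)%N.
  by rewrite ltnNge; apply/negP => mn; apply: mP; exact: agree_le uv.
by rewrite ltf_pV2 ?posrE ?ltr0n ?ltr_nat// (ltn_trans n0 nm).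
Qed.

Let dist_le u v (c : R) : 0 <= c ->
  (forall n, ~ agree n (sval u) (sval v) -> n%:R^-1 <= c) -> subshift_dist u v <= c.
Proof.
move=> c0 H; rewrite /subshift_dist; case: pselect => [ex|//].
by case: (ex_minnP ex) => m /asboolP mP _; exact: H.
Qed.

Let dist_ge0 u v : 0 <= subshift_dist u v.
Proof. by rewrite /subshift_dist; case: pselect => // ex; rewrite invr_ge0. Qed.

Let distxx u : subshift_dist u u = 0.
Proof.
rewrite /subshift_dist; case: pselect => // ex.
by exfalso; case: ex => n /asboolP H; apply: H => i _.
Qed.

Let dist_positivity u v : subshift_dist u v = 0 -> u = v.
Proof.
move=> d0; apply: subval_inj => n; apply: contrapT => nuv.
have := dist_ge (n := n.+1) (u := u) (v := v); rewrite d0 => H.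
have : n.+1%:R^-1 <= 0 :> R.
  by apply: H => uv; apply: nuv; exact: agree_le uv.
by rewrite leNgt invr_gt0 ltr0Sn.
Qed.

Let dist_sym u v : subshift_dist u v = subshift_dist v u.
Proof.
apply/eqP; rewrite eq_le; apply/andP; split; apply: dist_le => // n H;
  by apply: dist_ge => K; apply: H; exact: agree_sym.
Qed.

Let dist_triangle v u w : subshift_dist u w <= subshift_dist u v + subshift_dist v w.
Proof.
apply: dist_le => [|n nuw]; first exact: addr_ge0.
have [uv|nuv] := pselect (agree n (sval u) (sval v)).
  apply: (@le_trans _ _ (subshift_dist v w)); last by rewrite lerDr.
  by apply: dist_ge => vw; apply: nuw; exact: agree_trans vw.
apply: (@le_trans _ _ (subshift_dist u v)); last by rewrite lerDl.
exact: dist_ge.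
Qed.

HB.instance Definition _ := @isMetric.Build R subshift subshift_dist
  distxx dist_positivity dist_sym dist_triangle.

Let origin_subproof m : exists k : int,
  agree m (fun i => bi_infinite (i - 1)) (fun i => bi_infinite (k + i)).
Proof. by exists (-1) => i _; rewrite addrC. Qed.

(** The averages start at the first iterate while [y] starts at index 0, so the base point is
    shifted by one. *)
Definition origin : subshift := exist _ _ origin_subproof.

HB.instance Definition _ := isPointed.Build subshift origin.

Let Y : pointedMetricType R := subshift.

Lemma nbhs_subshiftP u (B : set subshift) :
  nbhs (u : Y) B <-> exists k, forall v, agree k (sval u) (sval v) -> B v.
Proof.
split=> [/nbhs_ballP[e /= e0 eB]|[k kB]].
  exists (Num.truncn e^-1).+1 => v uv; apply: eB; rewrite ballEmdist /=.
  apply: lt_le_trans (dist_lt _ uv) _ => //.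
  by rewrite -[leRHS]invrK lef_pV2 ?posrE ?invr_gt0// ltW// truncnS_gt.
apply/nbhs_ballP; exists k.+1%:R^-1; first by rewrite /= invr_gt0.
move=> v; rewrite ballEmdist /= => uv; apply: kB; apply: contrapT => nuv.
have : k.+1%:R^-1 <= subshift_dist u v.
  by apply: dist_ge => H; apply: nuv; exact: agree_le H.
by rewrite leNgt uv.
Qed.

Let shift_subproof (k : int) u m : exists k0 : int,
  agree m (fun i => sval u (i + k)) (fun i => bi_infinite (k0 + i)).
Proof.
have [k0 H] := svalP u (m + `|k|)%N.
exists (k0 + k) => i im; rewrite (H (i + k)); last by lia.
by rewrite -addrA (addrC k).
Qed.

Definition shift (k : int) u : subshift := exist _ _ (shift_subproof k u).

Lemma shift_continuous k : continuous (shift k : Y -> Y).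
Proof.
move=> u B /nbhs_subshiftP[n nB]; apply/nbhs_subshiftP; exists (n + `|k|)%N.
by move=> v uv; apply: nB => i im /=; apply: uv; lia.
Qed.

Lemma shiftK k : cancel (shift k) (shift (- k)).
Proof. by move=> u; apply: subval_inj => n i _ /=; rewrite subrK || rewrite addrNK. Qed.

Lemma shift_homeomorphism : homeomorphism (shift 1 : Y -> Y).
Proof.
split; first exact: shift_continuous.
exists (shift (-1)); split; last exact: shift_continuous.
  exact: shiftK.
by move=> u; rewrite -{1}[1]opprK; exact: shiftK.
Qed.

Lemma sval_iter_shift n u i : sval (iter n (shift 1) u) i = sval u (i + n%:Z).
Proof.
elim: n i => [|n IH] i /=; first by rewrite addr0.
by rewrite IH -addrA; congr (sval u (_ + _)); lia.
Qed.

Lemma iter_shift_origin n : sval (iter n.+1 (shift 1) origin) 0 = y n.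
Proof.
rewrite sval_iter_shift -[LHS]/(bi_infinite (0 + n.+1%:Z - 1)).
by rewrite -[RHS]/(bi_infinite n%:Z); congr bi_infinite; lia.
Qed.

Lemma coordinate_continuous (v : A -> R) : continuous (fun u : Y => v (sval u 0)).
Proof.
move=> u B /nbhs_singleton Bu; apply/nbhs_subshiftP; exists 1%N => w uw /=.
by rewrite -(uw 0).
Qed.

Lemma subshift_compact : compact [set: Y].
Proof.
rewrite compact_ultra => F UF _; have PF := @ultra_proper _ _ UF.
(* The alphabet is finite, so the ultrafilter selects one symbol at each coordinate. Any central
   window of the resulting sequence is shared with a point of the subshift. *)
have /choice[us Hus] : forall i : int, exists a : A, F [set u : Y | sval u i = a].
  move=> i; have [j Hj] : exists j : 'I_#|A|, F [set u : Y | sval u i = enum_val j].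
    apply: ultrafilter_pigeonhole; apply: filterS filterT => u _ /=.
    by exists (enum_rank (sval u i)); rewrite enum_rankK.
  by exists (enum_val j).
have Fagree m : F [set u : Y | agree m us (sval u)].
  have : F [set u : Y | forall j : 'I_m, sval u (Posz j) = us (Posz j) /\
      sval u (Negz j) = us (Negz j)].
    by apply: filter_forall => j; exact: filterI (Hus _) (Hus _).
  apply: filterS => u /= H [i|i] im; apply/esym.
    by have [-> _] := H (Ordinal (im : (i < m)%N)).
  have im' : (i < m)%N by apply: ltn_trans im; rewrite /=.
  by have [_ ->] := H (Ordinal im').
have Pus m : exists k : int, agree m us (fun i => bi_infinite (k + i)).
  have [u um] := filter_ex (Fagree m); have [k ku] := svalP u m.
  by exists k; exact: agree_trans ku.
exists (exist _ us Pus : subshift); split => // B /nbhs_subshiftP[k kB].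
by apply: filterS (Fagree k).
Qed.

Definition subwin (u : int -> A) (k : int) L := mkseq (fun j => u (k + j%:Z)) L.

Hypothesis few_words : forall e : R, 0 < e -> exists L0, forall L, (L0 <= L)%N ->
  exists Ws : seq (seq A), (forall p, win y p L \in Ws) /\
    (size Ws)%:R <= expR (e * L%:R) :> R.

(** Besides the words of [y], a window may meet the padding; it is then some number of symbols [a0]
    followed by a prefix of [y]. These [L + 1] words are absorbed by the enlarged exponent through
    [1 + t <= expR t]. *)
Lemma few_subwords (e : R) : 0 < e -> exists L0, forall L, (L0 <= L)%N ->
  exists Ws : seq (seq A), (forall u k, subwin (sval u) k L \in Ws) /\
    (size Ws)%:R <= expR (e * (L%:R + 2) + e^-1) :> R.
Proof.
move=> e0; have [L0 HL0] := few_words e0; exists L0 => L /HL0[Ws [HWs sWs]].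
exists (Ws ++ [seq nseq j a0 ++ win y 0 (L - j) | j <- iota 0 L.+1]); split.
  move=> u k; have [k0 H] := svalP u (`|k| + L)%N.
  have -> : subwin (sval u) k L = subwin bi_infinite (k0 + k) L.
    apply/eq_in_map => j; rewrite mem_iota add0n => /andP[_ jL].
    by rewrite -addrA; apply: H; lia.
  rewrite mem_cat; case: (k0 + k) => p; first by rewrite HWs.
  apply/orP; right; apply/mapP; exists (minn p.+1 L).
    by rewrite mem_iota add0n ltnS geq_minr.
  apply: (@eq_from_nth _ a0).
    by rewrite size_mkseq size_cat size_nseq size_win subnKC ?geq_minr.
  move=> i; rewrite size_mkseq => iL; rewrite nth_mkseq// nth_cat size_nseq.
  case: ltnP => ip.
    rewrite nth_nseq ip; have ip' : (i < p.+1)%N by apply: leq_trans ip _; exact: geq_minl.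
    have -> : Negz p + i%:Z = Negz (p - i) by lia.
    by [].
  have pi : (p.+1 <= i)%N by move: ip; rewrite geq_min => /orP[//|]; lia.
  have -> : minn p.+1 L = p.+1 by apply/minn_idPl; lia.
  rewrite nth_mkseq; last by lia.
  have -> : Negz p + i%:Z = Posz (i - p.+1) by lia.
  by [].
rewrite size_cat size_map size_iota natrD expRD.
set X := expR (e * (L%:R + 2)).
have WX : (size Ws)%:R <= X.
  by apply: (le_trans sWs); rewrite ler_expR ler_pM2l// lerDl.
have LX : L%:R + 2 <= e^-1 * X.
  rewrite mulrC ler_pdivlMr// mulrC.
  by have := expR_ge1Dx (e * (L%:R + 2)); rewrite -/X; lra.
have X0 : 0 < X by exact: expR_gt0.
have eX : (1 + e^-1) * X <= expR e^-1 * X by rewrite ler_pM2r// expR_ge1Dx.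
rewrite -natr1; move: WX LX eX; rewrite (mulrC X); lra.
Qed.

Lemma lebesgue_number (U : set (set Y)) : open_cover U ->
  exists m, forall u, exists2 O : set Y, U O & forall v, agree m (sval u) (sval v) -> O v.
Proof.
move=> [oU cU]; apply: contrapT => /forallNP nH.
have /choice[us Hus] : forall m, exists u : Y, forall O, U O ->
    ~ (forall v, agree m (sval u) (sval v) -> O v).
  move=> m; have /existsNP[u Hu] := nH m; exists u => O UO H.
  by apply: Hu; exists O.
have [u [_ clu]] : [set: Y] `&` cluster (us @ \oo) !=set0.
  by apply: subshift_compact; exact: filterT.
have [Q UQ Qu] : (\bigcup_(Q in U) Q) u by rewrite cU.
have /nbhs_subshiftP[k kO] : nbhs (u : Y) Q by apply: open_nbhs_nbhs; split => //; exact: oU.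
have nk : nbhs (u : Y) [set v | agree k (sval u) (sval v)].
  by apply/nbhs_subshiftP; exists k.
have Fk : (us @ \oo) [set us n | n in [set n | (k <= n)%N]].
  by exists k => // n kn; exists n.
have [_ [[n /= kn <-] /= un]] := clu _ _ Fk nk.
apply: (Hus n Q UQ) => v nv; apply: kO; apply: agree_trans un _.
exact: agree_le nv.
Qed.

(** The cover element chosen around the i-th iterate depends on coordinates at distance less than
    [m] from [i]. The word on the positions from [- m] to [n + m - 1] thus determines an element of
    the join. *)
Lemma cover_number_le (U : set (set Y)) m n (Ws : seq (seq A)) :
  (forall u, exists2 O : set Y, U O & forall v, agree m (sval u) (sval v) -> O v) ->
  (forall u k, subwin (sval u) k (n + 2 * m) \in Ws) ->
  cover_number (cover_join (shift 1 : Y -> Y) U n) <= (size Ws)%:R :> R.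
Proof.
move=> Hm HWs.
have /choice[cell HO] : forall u, exists O : set Y, U O /\
    forall v, agree m (sval u) (sval v) -> O v.
  by move=> u; have [Q UQ HQ] := Hm u; exists Q.
pose a u i := cell (iter i (shift 1) u).
pose B u : set Y := \bigcap_(i < n) (iter i (shift 1) @^-1` a u i).
have BP u v : subwin (sval u) (- m%:Z) (n + 2 * m) =
    subwin (sval v) (- m%:Z) (n + 2 * m) -> B u v.
  move=> uv i /= ni; have [_ H] := HO (iter i (shift 1) u); apply: H => j jm.
  rewrite !sval_iter_shift.
  pose d : int := j + i%:Z + m%:Z.
  have lt : (`|d| < n + 2 * m)%N by rewrite /d; lia.
  have := congr1 (fun s => nth a0 s `|d|%N) uv.
  rewrite !nth_mkseq// (_ : - m%:Z + `|d|%N%:Z = j + i%:Z)//.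
  by rewrite /d; lia.
have /choice[rep Hrep] : forall w : seq A, exists u, 
    (exists v, subwin (sval v) (- m%:Z) (n + 2 * m) = w) ->
    subwin (sval u) (- m%:Z) (n + 2 * m) = w.
  move=> w; have [[v vw]|nw] := pselect (exists v,
    subwin (sval v) (- m%:Z) (n + 2 * m) = w); first by exists v.
  by exists origin.
pose s := [seq B (rep x) | x <- Ws].
have [k [ks card_s]] := @card_set_seq (set Y) s.
apply: (@le_trans _ _ k%:R); last by rewrite ler_nat (leq_trans ks)// size_map.
apply: ge_inf; first by exists 0 => _ [? _ <-].
exists k => //; exists [set` s]; split => //.
  move=> C /= /mapP[w _ ->]; exists (a (rep w)) => // i.
  by have [] := HO (iter i (shift 1) (rep w)).
apply/seteqP; split => // v _.
exists (B (rep (subwin (sval v) (- m%:Z) (n + 2 * m)))).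
  by apply/mapP; exists (subwin (sval v) (- m%:Z) (n + 2 * m)).
by apply: BP; apply: Hrep; exists v.
Qed.

Lemma ln_cover_number_ge0 n :
  0 <= ln (cover_number (cover_join (shift 1 : Y -> Y) [set setT] n) : R).
Proof.
have E : cover_join (shift 1 : Y -> Y) [set setT] n = [set setT].
  apply/seteqP; split => [_ [a Ha <-]|_ ->].
    rewrite /= bigcapT// => i _; by rewrite (Ha i).
  by exists (fun=> setT) => //; rewrite bigcapT.
rewrite E; have [| | |k [V [_ _ _ ->]]] := @cover_number_attained R Y [set setT] [set setT].
- by [].
- exact: finite_set1.
- by rewrite bigcup_set1.
by case: k => [|k]; [rewrite ln0|rewrite ln_ge0// ler1n].
Qed.

Lemma subshift_top_entropy : top_entropy (shift 1 : Y -> Y) = 0%E :> \bar R.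
Proof.
apply/eqP; rewrite eq_le; apply/andP; split; last first.
  apply: (@le_trans _ _ (cover_entropy (shift 1 : Y -> Y) [set setT])).
    apply: limn_esup_ge => n; rewrite lee_fin divr_ge0//.
    exact: ln_cover_number_ge0.
  apply: ereal_sup_ubound; exists [set setT] => //; split; last by rewrite bigcup_set1.
  by move=> _ ->; exact: openT.
apply: ge_ereal_sup => _ [U oU <-]; apply/lee_addgt0Pr => e e0; rewrite add0e.
have [m Hm] := lebesgue_number oU.
have e2 : 0 < e / 2 by rewrite divr_gt0.
have [L0 HL0] := few_subwords e2.
(* The part of the exponent in [few_subwords] that does not grow with [n]; it is eventually below
   [e / 2 * n]. *)
pose c : R := e / 2 * ((2 * m)%:R + 2) + (e / 2)^-1.
apply: limn_esup_le; near=> n.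
have n0 : (0 < n)%N by near: n; exact: nbhs_infty_gt.
have nL : (L0 <= n + 2 * m)%N.
  by rewrite (leq_trans _ (leq_addr _ _))//; near: n; exact: nbhs_infty_ge.
have cn : c <= e / 2 * n%:R.
  rewrite mulrC -ler_pdivrMr//; near: n; exact: nbhs_infty_ger.
have [Ws [HWs sWs]] := HL0 _ nL.
have := cover_number_le Hm HWs.
set N := cover_number _ => NW.
rewrite lee_fin ler_pdivrMr ?ltr0n//.
have [N0|N0] := leP N 0; first by rewrite ln0// mulr_ge0// ltW.
apply: (@le_trans _ _ (ln (expR (e / 2 * ((n + 2 * m)%:R + 2) + (e / 2)^-1)))).
  by rewrite ler_ln ?posrE ?expR_gt0// (le_trans NW).
rewrite expRK natrD; move: cn; rewrite /c; lra.
Unshelve. all: by end_near. Qed.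

End subshift.

Theorem subshift_system (R : realType) (A : finType) (a0 : A) (y : nat -> A) :
  (forall e : R, 0 < e -> exists L0, forall L, (L0 <= L)%N ->
    exists Ws : seq (seq A), (forall p, win y p L \in Ws) /\
      (size Ws)%:R <= expR (e * L%:R) :> R) ->
  exists (Y : pointedMetricType R) (S : Y -> Y) (g : Y -> A) (u : Y),
    [/\ compact [set: Y], homeomorphism S, top_entropy S = 0%E :> \bar R,
      forall v : A -> R, continuous (v \o g) & forall n, g (iter n.+1 S u) = y n].
Proof.
move=> few; exists (subshift a0 y : pointedMetricType R), (shift 1),
  (fun u => sval u 0), (origin a0 y); split.
- exact: subshift_compact.
- exact: shift_homeomorphism.
- exact: subshift_top_entropy.
- exact: coordinate_continuous.
- exact: iter_shift_origin.
Qed.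

(** * Ultralimits of empirical measures *)

Section ultralimit_measure.
Context {R : realType} {X : pointedMetricType R}.
Variables (T : X -> X) (x : X) (U : set_system nat).
Hypothesis UU : UltraFilter U.
Hypothesis Uoo : forall m, U [set N | (m <= N)%N].
Hypothesis cptX : compact [set: X].

Let PU : ProperFilter U := @ultra_proper _ _ UU.

Lemma ultrafilter_cvg (u : nat -> R) (a b : R) : (forall N, a <= u N <= b) ->
  cvg (u @ U).
Proof.
move=> uab; have [l [_ clu]] : `[a, b] `&` cluster (u @ U) !=set0.
  apply: segment_compact; have : U (u @^-1` `[a, b]).
    by apply: filterS filterT => N _ /=; rewrite in_itv/= uab.
  exact.
apply/cvg_ex; exists l => B lB.
have [//|UnB] := in_ultra_setVsetC (u @^-1` B) UU.
by have [r [/= nBr Br]] := clu (~` B) B UnB lB.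
Qed.

(* N.-1 because orbit_avg T x N averages N + 1 values. *)
Let freq N (A : set X) : R := orbit_avg T x N.-1 (\1_A).

Let freq01 A N : 0 <= freq N A <= 1.
Proof.
rewrite /freq -empirical_prob; apply/andP; split; first exact: prob_ge0.
rewrite empirical_prob /orbit_avg mulrC ler_pdivrMr ?ltr0n// mul1r.
apply: (@le_trans _ _ (\sum_(n < N.-1.+1) 1)); last by rewrite sumr_const card_ord.
by apply: ler_sum => n _; rewrite indicE; case: (_ \in A).
Qed.

Let m (A : set X) : R := lim (freq N A @[N --> U]).

Let m_cvg A : freq N A @[N --> U] --> m A.
Proof. exact: (ultrafilter_cvg (freq01 A)). Qed.

Let m_ge0 A : 0 <= m A.
Proof.
apply: limr_ge; first exact: (ultrafilter_cvg (freq01 A)).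
by apply: nearW => N; have /andP[] := freq01 A N.
Qed.

Let mU A B : A `&` B = set0 -> m (A `|` B) = m A + m B.
Proof.
move=> AB; apply: (cvg_unique (@norm_hausdorff _ R) (@m_cvg _)).
rewrite (_ : freq ^~ (A `|` B) = freq ^~ A \+ freq ^~ B).
  by apply: cvgD; [exact: (@m_cvg A)|exact: (@m_cvg B)].
apply/funext => N; rewrite /freq /orbit_avg /= -mulrDr -big_split/=.
congr (_ * _); apply: eq_bigr => n _; rewrite !indicE in_setU.
set v := T _; have : ~~ ((v \in A) && (v \in B)).
  apply/negP => /andP[]; rewrite !inE => Av Bv.
  by have : (A `&` B) v by []; rewrite AB.
by case: (v \in A); case: (v \in B) => //= _; rewrite ?addr0 ?add0r.
Qed.

Let mT : m setT = 1.
Proof.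
apply: (cvg_unique (@norm_hausdorff _ R) (@m_cvg _)).
rewrite (_ : freq ^~ setT = cst 1); first exact: cvg_cst.
apply/funext => N; rewrite /freq -empirical_prob; exact: probT.
Qed.

(** The measure dominates the limit frequency [m] on closed sets, which gives the second claim. By
    [portmanteau] the empirical measures then converge to it along [U], and [U] contains all tails,
    so it is a cluster point. *)
Lemma ultralimit_measure : exists nu : weak_probability X,
  cluster (empirical_probability T x @ \oo) nu /\
  forall F, closed F -> forall e : R, 0 < e -> \forall N \near U,
    prob (empirical_probability T x N.-1) F <= prob nu F + e.
Proof.
have [nu Hnu] := content_probability m_ge0 mU cptX mT.
have Hc F : closed F -> forall e : R, 0 < e -> \forall N \near U,
    prob (empirical_probability T x N.-1) F <= prob nu F + e.
  move=> cF e e0; have /cvgrPdist_lt/(_ e e0) := @m_cvg F.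
  have mF : m F <= prob nu F.
    by rewrite -lee_fin -probE; [exact: Hnu|exact: closed_borel].
  apply: filterS => N; rewrite ltr_norml empirical_prob -/(freq N F); lra.
exists nu; split => //.
have cvgnu : (empirical_probability T x N.-1 : weak_probability X) @[N --> U] -->
    (nu : weak_probability X).
  apply: weak_cvg => f; apply: portmanteau => //.
  exact: cts_fun.
move=> A B [k _ kA] nB.
have UB : U [set N | B (empirical_probability T x N.-1)] := cvgnu B nB.
have [N [/= BN kN]] := filter_ex (filterI UB (Uoo k.+1)).
exists (empirical_probability T x N.-1); split => //.
by apply: kA => /=; move: kN; case: N {BN} => [|N].
Qed.

End ultralimit_measure.

Section null_level.
Context {R : realType} {X : pointedMetricType R}.
Variables (nu : probability (borel X) R) (D : R -> set X).
Hypothesis mD : forall t, measurable (D t : set (borel X)).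
Hypothesis disjD : forall s t, 0 <= s < 1 -> 0 <= t < 1 -> s <> t -> D s `&` D t = set0.

Let E n := [set t | 0 <= t < 1 /\ n.+1%:R^-1 < prob nu (D t)].

Let sum_levels (l : seq R) n : uniq l -> (forall t, t \in l -> E n t) ->
  exists2 B : set X, measurable (B : set (borel X)) &
  (size l)%:R / n.+1%:R <= prob nu B /\ forall y, B y -> exists2 t, t \in l & D t y.
Proof.
elim: l => [|t l IH] /=.
  move=> _ _; exists set0 => //; split => //; rewrite mul0r; exact: prob_ge0.
move=> /andP[tl ul] Hl; have [|B mB [HB BD]] := IH ul.
  by move=> s sl; apply: Hl; rewrite inE sl orbT.
have [t01 Et] := Hl t (mem_head t l).
exists (D t `|` B); first exact: measurableU.
split.
  rewrite /prob fine_measureU// -?/(prob nu _).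
    by rewrite -natr1 mulrDl mul1r addrC lerD// ltW.
  rewrite -subset0 => y [Dty /BD[s sl Dsy]].
  have [s01 _] : E n s by apply: Hl; rewrite inE sl orbT.
  rewrite -(disjD t01 s01)// => ts; by rewrite ts sl in tl.
move=> y [Dy|/BD[s sl Ds]]; first by exists t; rewrite ?mem_head.
by exists s; rewrite // inE sl orbT.
Qed.

Let finite_E n : finite_set (E n).
Proof.
apply: contrapT => infE; have [B BE nB] := infinite_set_fset n.+2 infE.
have [|C mC [HC _]] := @sum_levels (finmap.enum_fset B) n (finmap.fset_uniq B).
  by move=> t tB; apply: BE.
have C1 : prob nu C <= 1 by rewrite -(probT nu); apply: le_prob.
have : n.+2%:R / n.+1%:R <= 1 :> R.
  apply: le_trans C1; apply: le_trans HC; rewrite ler_wpM2r// ler_nat.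
  exact: nB.
by rewrite ler_pdivrMr ?ltr0n// mul1r ler_nat ltnn.
Qed.

(** Disjoint sets of measure above 1/(n+1) are finite in number, so the levels of positive measure
    are countable, whereas the unit interval has Lebesgue measure 1. *)
Lemma null_level : exists2 t : R, 0 <= t < 1 & prob nu (D t) = 0.
Proof.
apply: contrapT => nD.
have sub : `[0, 1[%classic `<=` \bigcup_n E n.
  move=> t /=; rewrite in_itv/= => t01.
  have pt : 0 < prob nu (D t).
    rewrite lt_neqAle prob_ge0 andbT; apply/eqP => p0; apply: nD.
    by exists t.
  exists (Num.truncn (prob nu (D t))^-1) => //; split => //.
  by rewrite -[ltRHS]invrK ltf_pV2 ?posrE ?invr_gt0// truncnS_gt.
have : countable (`[0, 1[%classic : set R).
  apply: sub_countable (subset_card_le sub) _.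
  by apply: bigcup_countable => // n _; apply: finite_set_countable; exact: finite_E.
move=> /countable_lebesgue_measure0; rewrite lebesgue_measure_itv/= lte01.
by rewrite oppr0 adde0 => /eqP; rewrite onee_eq0.
Qed.

End null_level.

(** [C] collects the labels of probability at least exp(- h), of which there are at most exp(h).
    Every other label contributes more than [h] times its probability to the entropy, unless that
    probability is zero. *)
Lemma typical_words {R : realType} d (X : measurableType d) (mu : probability X R)
    (I : finType) (xi : X -> I) (h : R) : measurable_partition xi -> 0 < h ->
  exists C : {set I}, #|C|%:R <= expR h /\
    fine (mu [set x | xi x \notin C]) * h <= partition_entropy mu xi.
Proof.
move=> mxi h0; pose p i := fine (mu (xi @^-1` [set i])).
have p0 i : 0 <= p i by exact: fine_measure_ge0.
have p1 i : p i <= 1.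
  by rewrite -(prob_partitionT mu mxi) (bigD1 i)//= lerDl sumr_ge0// => j _; exact: p0.
exists (finset (fun i => expR (- h) <= p i)); split.
  have : \sum_(i in (finset (fun i => expR (- h) <= p i))) expR (- h) <= 1.
    rewrite -(prob_partitionT mu mxi) big_mkcond/=; apply: ler_sum => i _.
    by rewrite inE; case: ifP => // _; exact: p0.
  rewrite sumr_const -[X in X <= _]mulr_natl expRN ler_pdivrMr ?expR_gt0//.
  by rewrite mul1r.
rewrite (prob_partition mu (fun i => i \notin (finset (fun i => expR (- h) <= p i))) mxi).
rewrite mulr_suml /partition_entropy -sumrN big_mkcond/=; apply: ler_sum => i _.
rewrite -/(p i) inE; case: ifP => [|_]; last first.
  by rewrite -mulrN mulr_ge0// oppr_ge0 ln_le0.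
rewrite -ltNge => ph; have := p0 i; rewrite le_eqVlt => /orP[/eqP <-|pi0].
  by rewrite !mul0r oppr0.
rewrite -mulrN ler_pM2l// lerNr -[leRHS]expRK ler_ln ?posrE ?expR_gt0//.
exact: ltW.
Qed.

Lemma sum_count {R : pzSemiRingType} (P : pred nat) N :
  \sum_(n < N) (P n)%:R = (count P (iota 0 N))%:R :> R.
Proof.
rewrite -(big_mkord xpredT (fun n => (P n)%:R)) /index_iota subn0.
by elim: (iota 0 N) => [|n l IH]; rewrite ?big_nil// big_cons IH /= natrD.
Qed.

(** * Quantization and conclusion *)

Section quantization.
Context {R : realType} {X : pointedMetricType R}.
Variables (nu : probability (borel X) R) (f : X -> R) (M e : R).
Hypotheses (cf : continuous f) (fM : forall x, `|f x| <= M) (e0 : 0 < e).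

Let h x := (f x + M) / e.

Let h_ge0 x : 0 <= h x.
Proof. by rewrite divr_ge0 ?(ltW e0)//; have := fM x; rewrite ler_norml; lra. Qed.

Let h_le x : h x <= 2 * M / e.
Proof.
by rewrite ler_pM2r ?invr_gt0//; have := fM x; rewrite ler_norml; lra.
Qed.

Let ch : continuous h.
Proof.
move=> x; apply: cvgMl; apply: cvgD; first exact: cf.
exact: cvg_cst.
Qed.

Let B := (Num.truncn (2 * M / e)).+2.
(** For [0 <= t < 1] this is where [h + t] is an integer. As [h + t] stays below [B], finitely many
    levels suffice and the set is closed. *)
Let D (t : R) : set X := \bigcup_(k in `I_B.+1) h @^-1` [set r | r = k%:R - t].

Let closed_D t : closed (D t).
Proof.
apply: closed_bigcup => // k _; apply: closed_comp => [x _|]; first exact: ch.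
exact: closed_eq.
Qed.

Let disjoint_D s t : 0 <= s < 1 -> 0 <= t < 1 -> s <> t -> D s `&` D t = set0.
Proof.
move=> /andP[s0 s1] /andP[t0 t1] st; rewrite -subset0 => x [[k _ /= hk] [l _ /= hl]].
apply: st; have kl : (k < l.+1)%N by rewrite -(ltr_nat R) -natr1; lra.
have lk : (l < k.+1)%N by rewrite -(ltr_nat R) -natr1; lra.
have {kl lk} E : k = l by lia.
by move: hk hl; rewrite E; lra.
Qed.

(* Rounding h down after a shift by t is locally constant off D t; t is chosen
   such that D t is nu-null, which is possible since these sets are disjoint. *)
Lemma quantization : exists (n : nat) (q : borel X -> 'I_n) (v : 'I_n -> R) (Z : set X),
  [/\ measurable_partition q, forall x, `|f x - v (q x)| <= e, closed Z, prob nu Z = 0 &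
    forall x, ~ Z x -> exists2 V : set X, open V /\ V x &
      forall y, V y -> q y = q x /\ ~ Z y].
Proof.
have mD t : measurable (D t : set (borel X)) by apply: closed_borel; exact: closed_D.
have [t /andP[t0 t1] Dt0] := null_level nu mD disjoint_D.
pose g x := h x + t; have g_ge0 x : 0 <= g x by rewrite addr_ge0.
have cg : continuous g by move=> x; apply: cvgD; [exact: ch|exact: cvg_cst].
have gB x : g x < B%:R.
  have BE : B%:R = (Num.truncn (2 * M / e)).+1%:R + 1 :> R by rewrite natr1.
  have := h_le x; have := truncnS_gt (2 * M / e); rewrite /g BE; lra.
have truncB x : (Num.truncn (g x) < B.+1)%N.
  by rewrite ltnS -(ler_nat R) (le_trans _ (ltW (gB x)))// truncn_le.
pose q x : 'I_B.+1 := inord (Num.truncn (g x)).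
have qE x : q x = Num.truncn (g x) :> nat by rewrite inordK.
have gD x k : ~ D t x -> g x != k%:R.
  move=> nD; apply/eqP => gk; apply: nD; exists k; last by move: gk; rewrite /g /=; lra.
  have := gB x; rewrite gk ltr_nat /=; lia.
exists B.+1, q, (fun i : 'I_B.+1 => (i%:R - t) * e - M), (D t); split => //.
- move=> i; rewrite (_ : _ @^-1` _ = g @^-1` [set r | i%:R <= r] `&`
    g @^-1` [set r | r < i.+1%:R]).
    apply: measurableI.
      apply: closed_borel; apply: closed_comp; last exact: closed_ge.
      by move=> x _; exact: cg.
    apply: open_borel; apply: open_comp; last exact: open_lt.
    by move=> x _; exact: cg.
  apply/seteqP; split => x /=.
    by move=> <-; rewrite qE; have /andP[] := truncn_itv (g_ge0 x).
  move=> [h1 h2]; apply: ord_inj; rewrite qE; apply: truncn_def.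
  by rewrite h1 h2.
- move=> x; rewrite qE; have /andP[h1 h2] := truncn_itv (g_ge0 x).
  have fE : f x = (g x - t) * e - M by rewrite /g /h addrK divfK ?gt_eqF// addrK.
  rewrite fE; set k := (Num.truncn _)%:R in h1 *.
  have h3 : g x < k + 1 by rewrite natr1.
  have -> : (g x - t) * e - M - ((k - t) * e - M) = (g x - k) * e by ring.
  rewrite normrM (gtr0_norm e0) ler_piMl ?(ltW e0)// ger0_norm; lra.
- move=> x nD; pose k := Num.truncn (g x).
  exists (g @^-1` [set r | k%:R < r] `&` g @^-1` [set r | r < k.+1%:R]).
    have /andP[h1 h2] := truncn_itv (g_ge0 x); split.
      by apply: openI; apply: open_comp => [y _|];
        [exact: cg|exact: open_gt|exact: cg|exact: open_lt].
    by split => //=; rewrite lt_neqAle h1 eq_sym gD.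
  move=> y [/= h1 h2]; have ky : Num.truncn (g y) = k.
    by apply: truncn_def; rewrite (ltW h1) h2.
  split; first by apply: ord_inj; rewrite !qE ky.
  move=> [l _ /= hl]; have gl : g y = l%:R by rewrite /g hl subrK.
  by move: h1 h2; rewrite gl !ltr_nat; lia.
Qed.

End quantization.

(** * Word statistics along the orbit *)

Section words_of_zero_entropy_orbit.
Context {R : realType} {X : pointedMetricType R}.
Variables (T : X -> X) (x : X) (nu : probability (borel X) R) (U : set_system nat).
Hypotheses (PU : ProperFilter U) (Uoo : forall m, U [set N | (m <= N)%N]).
Hypothesis cT : continuous T.
Hypothesis inv : forall A, measurable (A : set (borel X)) -> nu (T @^-1` A) = nu A.
Hypothesis nu_closed : forall F, closed F -> forall e : R, 0 < e -> \forall N \near U,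
  prob (empirical_probability T x N.-1) F <= prob nu F + e.
Hypothesis zero_entropy : ks_entropy (T : borel X -> borel X) nu = 0%E.
Variables (k : nat) (q : borel X -> 'I_k) (Z : set X).
Hypotheses (mq : measurable_partition q) (cZ : closed Z) (Z0 : prob nu Z = 0).
Hypothesis q_locally_constant : forall y, ~ Z y -> exists2 V : set X, open V /\ V y &
  forall w, V w -> q w = q y /\ ~ Z w.

Local Notation TB := (T : borel X -> borel X).
Let mTB := continuous_borel_preimage cT.

Let cT_iter i : continuous (iter i T).
Proof.
elim: i => [|i IH] y; first exact: cvg_id.
by apply: continuous_comp; [exact: IH|exact: cT].
Qed.

Let Zs K : set X := \bigcup_(i < K) (iter i T @^-1` Z).

Let closed_Zs K : closed (Zs K).
Proof.
apply: closed_bigcup => // i _; apply: closed_comp => // y _; exact: cT_iter.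
Qed.

Let prob_Zs K : prob nu (Zs K) = 0.
Proof.
have mi i : measurable (iter i T @^-1` Z : set (borel X)).
  by apply: (measurable_iter (T := TB) mTB); exact: closed_borel.
rewrite /prob (_ : nu (Zs K) = 0%E)//; apply/eqP; rewrite eq_le measure_ge0 andbT.
apply: (@le_trans _ _ (\sum_(i < K) nu (iter i T @^-1` Z))%E).
  rewrite /Zs bigcup_mkord; exact: (@Boole_inequality _ _ (borel X) nu (fun i => iter i T @^-1` Z) K (fun i _ => mi i)).
rewrite big1// => i _.
rewrite (measure_iter (T := TB) mTB inv)//; last exact: closed_borel.
by rewrite probE ?Z0//; exact: closed_borel.
Qed.

(** The word of length [K] is locally constant where the first [K] iterates avoid [Z]. Openness
    makes the complement closed, as [nu_closed] demands. *)
Let open_words K (C : {set {ffun 'I_K -> 'I_k}}) :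
  open [set y | partition_join TB q K y \in C /\ ~ Zs K y].
Proof.
rewrite openE => y [yC nZ].
have nZi (i : 'I_K) : ~ Z (iter i T y) by move=> Zi; apply: nZ; exists i => //=.
have /choice[V HV] : forall i : 'I_K, exists V : set X, [/\ open V, V (iter i T y) &
    forall w, V w -> q w = q (iter i T y) /\ ~ Z w].
  by move=> i; have [V [oV Vy] H] := q_locally_constant (nZi i); exists V.
have near_y : nbhs y [set w | forall i : 'I_K, V i (iter i T w)].
  apply: filter_forall => i; have [oV Vy _] := HV i.
  by apply: (@cT_iter i y); exact: open_nbhs_nbhs.
apply: filterS near_y => w Hw.
have E : partition_join TB q K w = partition_join TB q K y.
  by apply/ffunP => i; rewrite !ffunE; have [_ _ /(_ _ (Hw i))[]] := HV i.
split; first by change (is_true (partition_join TB q K w \in C)); rewrite E.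
move=> [i iK Zw]; have [_ _ /(_ _ (Hw (Ordinal iK)))[_]] := HV (Ordinal iK).
exact.
Qed.

Let orbit_label n := q (iter n.+1 T x).

Let word K (w : {ffun 'I_K -> 'I_k}) : seq 'I_k := [seq w i | i <- enum 'I_K].

Let win_orbit_label K n :
  win orbit_label n K = word (partition_join TB q K (iter n.+1 T x)).
Proof.
rewrite /win /mkseq -val_enum_ord -map_comp; apply: eq_map => i.
rewrite [RHS]ffunE /orbit_label /comp.
have -> : (n + val i).+1 = (i + n.+1)%N by rewrite /=; lia.
by rewrite iterD.
Qed.

Lemma few_orbit_words (d : R) : 0 < d -> exists K0, forall K, (K0 <= K)%N ->
  exists C : seq (seq 'I_k), (size C)%:R <= expR (d * K%:R) :> R /\
    U [set N | (count (fun n => win (fun n => q (iter n.+1 T x)) n K \notin C)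
      (iota 0 N))%:R <= d * N%:R].
Proof.
move=> d0; have d2 : 0 < d / 2 by rewrite divr_gt0.
(* With [h = d / 2 * K] in [typical_words], an entropy below [(d / 2) ^ 2 * K] leaves the atypical
   words a mass of at most [d / 2]; [nu_closed] adds another [d / 2]. *)
have : (ks_entropy_partition TB nu q < (d / 2 * (d / 2))%:E)%E.
  apply: (@le_lt_trans _ _ 0%E); last by rewrite lte_fin mulr_gt0.
  by rewrite -zero_entropy; apply: ereal_sup_ubound; exists k, q.
move=> /limn_esup_lt[K1 _ HK1]; exists K1.+1 => K K1K.
have K0 : 0 < K%:R :> R by rewrite ltr0n (leq_trans _ K1K).
have mj := @measurable_partition_join _ _ TB _ q mTB mq K.
have dK : 0 < d / 2 * K%:R by rewrite mulr_gt0.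
have [C [sC HC]] := typical_words nu mj dK.
have bad : prob nu [set y | partition_join TB q K y \notin C] <= d / 2.
  have := HK1 K (ltnW K1K); rewrite /= lte_fin ltr_pdivrMr// => h.
  rewrite -(ler_pM2r dK); apply: le_trans HC _; rewrite mulrA ltW//.
exists [seq word w | w <- enum C]; split.
  rewrite size_map -cardE; apply: le_trans sC _; rewrite ler_expR ler_pM2r//; lra.
pose G := [set y | partition_join TB q K y \in C /\ ~ Zs K y].
have oG : open G by exact: open_words.
have mZ : measurable (Zs K : set (borel X)) by exact: closed_borel.
have mC := fin_partition_measurable (fun w => w \notin C) mj.
have G'le : prob nu (~` G) <= d / 2.
  apply: (@le_trans _ _ (prob nu ([set y | partition_join TB q K y \notin C] `|` Zs K))).
    apply: le_prob; [exact: (measurableC (open_borel oG))|exact: measurableU|].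
    move=> y nG; have [yC|yC] := boolP (partition_join TB q K y \in C); last by left.
    by right; apply: contrapT => nZ; apply: nG.
  rewrite -lee_fin -probE; last exact: measurableU.
  apply: le_trans (measureU2 _ mC mZ) _.
  rewrite [X in (X + _)%E](probE nu mC) [X in (_ + X)%E](probE nu mZ).
  by rewrite prob_Zs adde0 lee_fin.
have near_U := nu_closed (open_closedC oG) d2.
(* Positive [N] ensures [N.-1.+1 = N], so that the average at [N.-1] is over exactly [N] points. *)
apply: filterS (filterI near_U (Uoo 1)) => N [/= HN N0].
have NE : N.-1.+1 = N by rewrite prednK.
move: HN; rewrite empirical_prob /orbit_avg NE => HN.
have N0' : 0 < N%:R :> R by rewrite ltr0n.
have {}HN : \sum_(n < N) (\1_(~` G) (iter n.+1 T x) : R) <= d * N%:R.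
  rewrite -ler_pdivrMr// mulrC; apply: le_trans HN _; lra.
apply: le_trans HN; rewrite -sum_count; apply: ler_sum => n _.
rewrite indicE -/orbit_label.
have [bad_n|] := boolP (_ \notin _); last by move=> _ /=; case: (_ \in _).
rewrite mem_set// => -[gC _]; move: bad_n; rewrite -/orbit_label win_orbit_label.
by rewrite map_f// mem_enum.
Qed.

End words_of_zero_entropy_orbit.

(** * The two implications *)

Section conditions.
Context {R : realType} {I : index_set}.
Variable z : I -> R.
Hypothesis hz : forall i : I, z i \in [:: -1; 0; 1].

Let z_le1 i : `|z i| <= 1.
Proof.
by have := hz i; rewrite !inE => /or3P[] /eqP ->; rewrite ?normrN ?normr1 ?normr0.
Qed.

Lemma condition_S_S0 : condition_S z -> condition_S0 z.
Proof.
move=> HS X T cptX hT top0 f x cf; apply: HS => // nu clnu.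
have [cT _] := hT.
apply: zero_top_entropy_ks_entropy => // A mA.
exact: (cluster_invariant cptX cT clnu mA).
Qed.

Lemma weighted_average_near (X Y : Type) (T : X -> X) (S : Y -> Y) (f : X -> R)
    (g : Y -> R) (x : X) (u : Y) (P : pred nat) (e V : R) (N : nat) : (0 < N)%N ->
  0 <= e -> (forall n, `|f (iter n.+1 T x) - g (iter n.+1 S u)| <= e + V * (P n)%:R) ->
  `|weighted_average T f x z N - weighted_average S g u z N| <=
    e + V * (count P (iota 0 N))%:R / N%:R.
Proof.
move=> N0 e0 H; have N0' : 0 < N%:R :> R by rewrite ltr0n.
rewrite /weighted_average -mulrBr -sumrB normrM ger0_norm ?invr_ge0//.
rewrite mulrC ler_pdivrMr// mulrDl divfK ?gt_eqF//.
apply: le_trans (ler_norm_sum _ _ _) _.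
apply: (@le_trans _ _ (\sum_(n < N) (e + V * (P n)%:R))).
  apply: ler_sum => n _; rewrite -mulrBl normrM; apply: le_trans (H n).
  by rewrite ler_piMr.
rewrite big_split/= sumr_const card_ord -mulr_sumr sum_count. by rewrite -[X in X + _ <= _]mulr_natr.
Qed.

Lemma condition_S0_S : condition_S0 z -> condition_S z.
Proof.
move=> HS0 X T cptX [cT hT] f x cf detx.
apply/cvgrPdist_lt => e e0; apply: contrapT => ne.
pose S := [set N | e <= `|weighted_average T f x z N|].
have freqS m : exists2 N, (m <= N)%N & S N.
  apply: contrapT => nS; apply: ne; exists m => // N mN /=.
  rewrite sub0r normrN ltNge; apply/negP => eN; apply: nS; by exists N.
have PS : ProperFilter (within S \oo).
  apply: Build_ProperFilter_ex => P [m _ mP].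
  by have [N mN SN] := freqS m; exists N; exact: mP.
have [U [UU subU]] := ultraFilterLemma PS.
have PU := @ultra_proper _ _ UU.
have Uoo m : U [set N | (m <= N)%N] by apply: subU; exists m.
have US : U S by apply: subU; exists 0%N.
have [nu [clnu nu_closed]] := ultralimit_measure T x UU Uoo cptX.
have [M [M0 fM]] := continuous_bounded cptX cf.
have e4 : 0 < e / 4 by rewrite divr_gt0.
have [k [q [v [Z [mq fq cZ Z0 lcq]]]]] := quantization nu cf fM e4.
have inv A : measurable (A : set (borel X)) ->
    (nu : probability (borel X) R) (T @^-1` A) = (nu : probability (borel X) R) A.
  by move=> mA; exact: (cluster_invariant cptX cT clnu mA).
have words := few_orbit_words PU Uoo cT inv nu_closed (detx nu clnu) mq cZ Z0 lcq.
pose V : R := 2 * \sum_i `|v i| + 1.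
have vV i j : `|v i - v j| <= V.
  have sub i' : `|v i'| <= \sum_l `|v l|.
    by rewrite (bigD1 i')//= lerDl sumr_ge0.
  by rewrite (le_trans (ler_normB _ _))//; have := sub i; have := sub j; rewrite /V; lra.
have V0 : 0 < V by rewrite ltr_wpDl// mulr_ge0// sumr_ge0.
(* Changing a proportion e/(4V) of the symbols costs at most [e / 4], and quantization costs another
   [e / 4]. The new average is below [e / 2] at large times, so the old one is below [e], against
   the choice of [S]. *)
have eta0 : 0 < e / 4 / V by rewrite divr_gt0.
(* The label of [iter 1 T x] serves as the blank symbol: any element of the alphabet would do. *)
have [y [few often]] := zero_entropy_approximation (q (iter 1 T x)) UU Uoo US eta0 words.
have [Y [Sh [g [u [cptY hY topY cg gy]]]]] := subshift_system (q (iter 1 T x)) few.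
have /cvgrPdist_lt/(_ (e / 2)) := HS0 Y Sh cptY hY topY (v \o g) u (cg v).
have e2 : 0 < e / 2 by rewrite divr_gt0.
move=> /(_ e2)[m _ Hm]; have [N [mN SN cN]] := often (maxn m 1).
have {}Hm := Hm N (leq_trans (leq_maxl _ _) mN).
have N0 : (0 < N)%N by exact: leq_trans (leq_maxr _ _) mN.
have N0' : 0 < N%:R :> R by rewrite ltr0n.
pose P n := y n != q (iter n.+1 T x).
have near_f n : `|f (iter n.+1 T x) - (v \o g) (iter n.+1 Sh u)| <= e / 4 + V * (P n)%:R.
  rewrite /comp gy /P; case: eqVneq => [->|_] /=.
    by rewrite mulr0 addr0; exact: fq.
  rewrite mulr1 -(subrKA (v (q (iter n.+1 T x)))).
  by apply: le_trans (ler_normD _ _) _; apply: lerD; [exact: fq|exact: vV].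
have := weighted_average_near N0 (ltW e4) near_f.
have cV : V * (count P (iota 0 N))%:R / N%:R <= e / 4.
  by rewrite ler_pdivrMr// mulrC -ler_pdivlMr// mulrAC.
have tri := ler_normD (weighted_average T f x z N - weighted_average Sh (v \o g) u z N)
  (weighted_average Sh (v \o g) u z N).
rewrite subrK in tri; move: Hm SN; rewrite /S /= sub0r normrN; lra.
Qed.

End conditions.

Theorem theorem4p24 (R : realType) (I : index_set) (z : I -> R)
    (hz : forall i : I, z i \in [:: -1; 0; 1]) :
  condition_S0 z <-> condition_S z.
Proof.
by split; [exact: condition_S0_S|exact: condition_S_S0].
Qed.
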